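(* Let $\mathcal{T}$ be a Krull-Schmidt triangulated category. If $\mathcal{T}$ has an indecomposable silting object, then the action of iterated irreducible mutation on $\mathrm{silt}\,\mathcal{T}$ is transitive; that is, for any $\mathcal{M},\mathcal{N}\in\mathrm{silt}\,\mathcal{T}$, $\mathcal{N}$ can be obtained from $\mathcal{M}$ by a finite sequence of irreducible (left or right) mutations.
   Context: A ''subcategory'' always means a full subcategory closed under isomorphisms, finite coproducts and direct summands; $\mathrm{add}\,\mathcal{X}$ is the smallest such subcategory containing $\mathcal{X}$. $\mathcal{T}$ is Krull-Schmidt if any object is a finite coproduct of objects with local endomorphism rings. A subcategory $\mathcal{M}$ of $\mathcal{T}$ is silting if $\mathrm{Hom}_{\mathcal{T}}(M,M'[i])=0$ for all $M,M'\in\mathcal{M}$, $i>0$, and the smallest thick subcategory containing $\mathcal{M}$ is $\mathcal{T}$; $\mathrm{silt}\,\mathcal{T}$ is the collection of silting subcategories. An object $M$ is silting if $\mathrm{add}\,M$ is. A left $\mathcal{D}$-approximation of $M$ is a morphism $f:M\to D$ with $D\in\mathcal{D}$ such that $\mathrm{Hom}_{\mathcal{T}}(f,D')$ is surjective for all $D'\in\mathcal{D}$; $\mathcal{D}$ is covariantly finite in $\mathcal{M}$ if every object of $\mathcal{M}$ has one. Right approximations and contravariant finiteness are dual. For $\mathcal{D}$ covariantly finite in $\mathcal{M}$, take for each $M\in\mathcal{M}$ a triangle $M\xrightarrow{f}D\to N_M\to M[1]$ with $f$ a left $\mathcal{D}$-approximation and put $\mu^+(\mathcal{M};\mathcal{D}):=\mathrm{add}(\mathcal{D}\cup\{N_M\mid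 M\in\mathcal{M}\})$ (left mutation). Dually, for $\mathcal{D}$ contravariantly finite, using triangles $N_M\to D\xrightarrow{g}M\to N_M[1]$ with $g$ a right $\mathcal{D}$-approximation, put $\mu^-(\mathcal{M};\mathcal{D}):=\mathrm{add}(\mathcal{D}\cup\{N_M\mid M\in\mathcal{M}\})$ (right mutation). These do not depend on choices. A mutation is irreducible if $\mathcal{D}$ is obtained from $\mathcal{M}$ by removing exactly one isomorphism class of indecomposable objects, i.e. $\#(\mathrm{ind}\,\mathcal{M}\setminus\mathrm{ind}\,\mathcal{D})=1$, where $\mathrm{ind}$ denotes the set of isomorphism classes of indecomposable objects. *)

(* Defs.v *)
From HB Require Import structures.
From Stdlib Require Export Relations.Relation_Operators.
From mathcomp Require Export all_boot all_algebra.
From mathcomp Require Export boolp classical_sets.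

Set Implicit Arguments.
Unset Strict Implicit.
Unset Printing Implicit Defensive.

Import GRing.Theory.
Local Open Scope ring_scope.
Local Open Scope classical_set_scope.

Reserved Notation "g \co f" (at level 40, left associativity).

Record preadditive_cat := PreadditiveCat {
  obj :> Type;
  hom : obj -> obj -> zmodType;
  idm : forall X, hom X X;
  comp : forall X Y Z, hom Y Z -> hom X Y -> hom X Z;
  compA : forall X Y Z W (h : hom Z W) (g : hom Y Z) (f : hom X Y),
    comp h (comp g f) = comp (comp h g) f;
  comp1m : forall X Y (f : hom X Y), comp (idm Y) f = f;
  compm1 : forall X Y (f : hom X Y), comp f (idm X) = f;
  compDl : forall X Y Z (g1 g2 : hom Y Z) (f : hom X Y),
    comp (g1 + g2) f = comp g1 f + comp g2 f;
  compDr : forall X Y Z (g : hom Y Z) (f1 f2 : hom X Y),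
    comp g (f1 + f2) = comp g f1 + comp g f2
}.

Arguments hom {p}.
Arguments idm {p}.

Notation "g \co f" := (comp g f).

Section Preadditive.
Variable C : preadditive_cat.
Implicit Types X Y Z : C.

Definition is_iso X Y (f : hom X Y) : Prop :=
  exists g : hom Y X, g \co f = idm X /\ f \co g = idm Y.

Definition isomorphic X Y : Prop := exists f : hom X Y, is_iso f.

(* The case n = 0 says that S is an initial object. *)
Definition is_coproduct n (F : 'I_n -> C) (S : C)
    (inj : forall i, hom (F i) S) : Prop :=
  forall Y (f : forall i, hom (F i) Y),
    exists! h : hom S Y, forall i, h \co inj i = f i.

Definition is_binary_coproduct X Y S (i : hom X S) (j : hom Y S) : Prop :=
  forall Z (f : hom X Z) (g : hom Y Z),
    exists! h : hom S Z, h \co i = f /\ h \co j = g.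

Definition is_zero_obj X : Prop :=
  forall Y, (forall f : hom X Y, f = 0) /\ (forall f : hom Y X, f = 0).

Definition indecomposable X : Prop :=
  ~ is_zero_obj X /\
  forall A B (i : hom A X) (j : hom B X),
    is_binary_coproduct i j -> is_zero_obj A \/ is_zero_obj B.

Definition End X : Type := hom X X.

HB.instance Definition _ X := GRing.Zmodule.on (End X).

HB.instance Definition _ X := GRing.Zmodule_isPzRing.Build (End X)
  (@compA C X X X X) (@comp1m C X X) (@compm1 C X X)
  (@compDl C X X X) (@compDr C X X X).

End Preadditive.

Definition invertible (R : pzRingType) (a : R) : Prop :=
  exists b, b * a = 1 /\ a * b = 1.

Definition local_ring (R : pzRingType) : Prop :=
  (1 : R) <> 0 /\
  forall a b : R, ~ invertible a -> ~ invertible b -> ~ invertible (a + b).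

Definition krull_schmidt (C : preadditive_cat) : Prop :=
  forall X : C, exists n (F : 'I_n -> C) (inj : forall i, hom (F i) X),
    is_coproduct inj /\ forall i, local_ring (End (F i)).

Record additive_cat := AdditiveCat {
  additive_base :> preadditive_cat;
  has_coproducts : forall n (F : 'I_n -> additive_base),
    exists S (inj : forall i, hom (F i) S), is_coproduct inj
}.

Record additive_functor (C D : preadditive_cat) := AdditiveFunctor {
  fobj :> C -> D;
  fmap : forall X Y, hom X Y -> hom (fobj X) (fobj Y);
  fmap1 : forall X, fmap (idm X) = idm (fobj X);
  fmap_comp : forall X Y Z (g : hom Y Z) (f : hom X Y),
    fmap (g \co f) = fmap g \co fmap f;
  fmapD : forall X Y (f g : hom X Y), fmap (f + g) = fmap f + fmap g
}.

Arguments fmap {C D} a {X Y}.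

(* [shift] is the suspension [1] and [unshift] a quasi-inverse [-1]; the
   suspension is only required to be an autoequivalence.
   [dist f g h] : X -f-> Y -g-> Z -h-> X[1] is a distinguished triangle. *)
Record triangulated_cat := TriangulatedCat {
  triangulated_base :> additive_cat;
  shift : additive_functor triangulated_base triangulated_base;
  unshift : additive_functor triangulated_base triangulated_base;
  unshift_shift : exists e : forall X, hom (unshift (shift X)) X,
    (forall X, is_iso (e X)) /\
    (forall X Y (f : hom X Y), f \co e X = e Y \co fmap unshift (fmap shift f));
  shift_unshift : exists e : forall X, hom (shift (unshift X)) X,
    (forall X, is_iso (e X)) /\
    (forall X Y (f : hom X Y), f \co e X = e Y \co fmap shift (fmap unshift f));
  dist : forall X Y Z : triangulated_base,
    hom X Y -> hom Y Z -> hom Z (shift X) -> Prop;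
  dist_iso : forall X Y Z X' Y' Z'
      (f : hom X Y) (g : hom Y Z) (h : hom Z (shift X))
      (f' : hom X' Y') (g' : hom Y' Z') (h' : hom Z' (shift X'))
      (a : hom X X') (b : hom Y Y') (c : hom Z Z'),
    is_iso a -> is_iso b -> is_iso c ->
    b \co f = f' \co a -> c \co g = g' \co b -> fmap shift a \co h = h' \co c ->
    dist f g h -> dist f' g' h';
  dist_id : forall X Z, is_zero_obj Z ->
    dist (idm X) (0 : hom X Z) (0 : hom Z (shift X));
  dist_cone : forall X Y (f : hom X Y),
    exists Z (g : hom Y Z) (h : hom Z (shift X)), dist f g h;
  dist_rotate : forall X Y Z (f : hom X Y) (g : hom Y Z) (h : hom Z (shift X)),
    dist f g h <-> dist g h (- fmap shift f);
  dist_morphism : forall X Y Z X' Y' Z'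
      (f : hom X Y) (g : hom Y Z) (h : hom Z (shift X))
      (f' : hom X' Y') (g' : hom Y' Z') (h' : hom Z' (shift X'))
      (a : hom X X') (b : hom Y Y'),
    dist f g h -> dist f' g' h' -> b \co f = f' \co a ->
    exists c : hom Z Z', c \co g = g' \co b /\ fmap shift a \co h = h' \co c;
  dist_octahedron : forall X Y Z X' Y' Z' (f : hom X Y) (g : hom Y Z)
      (f1 : hom Y Z') (f2 : hom Z' (shift X))
      (g1 : hom Z X') (g2 : hom X' (shift Y))
      (h1 : hom Z Y') (h2 : hom Y' (shift X)),
    dist f f1 f2 -> dist g g1 g2 -> dist (g \co f) h1 h2 ->
    exists (u : hom Z' Y') (v : hom Y' X'),
      [/\ dist u v (fmap shift f1 \co g2),
          u \co f1 = h1 \co g, h2 \co u = f2,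
          v \co h1 = g1 & g2 \co v = fmap shift f \co h2]
}.

Arguments shift {t}.
Arguments unshift {t}.

Section Silting.
Variable T : triangulated_cat.
Implicit Types (X Y Z : T) (D M N : set T).

Definition subcategory M : Prop :=
  [/\ forall X Y, isomorphic X Y -> M X -> M Y,
      forall n (F : 'I_n -> T) S (inj : forall i, hom (F i) S),
        is_coproduct inj -> (forall i, M (F i)) -> M S
    & forall X Y S (i : hom X S) (j : hom Y S),
        is_binary_coproduct i j -> M S -> M X].

Definition add M : set T := smallest subcategory M.

Definition thick M : Prop :=
  [/\ subcategory M,
      forall X, M X -> M (shift X),
      forall X, M X -> M (unshift X)
    & forall X Y Z (f : hom X Y) (g : hom Y Z) (h : hom Z (shift X)),
        dist f g h -> M X -> M Y -> M Z].

Definition silting M : Prop :=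
  [/\ subcategory M,
      forall X Y i, M X -> M Y -> (0 < i)%N ->
        forall f : hom X (iter i shift Y), f = 0
    & smallest thick M = setT].

Definition silt : set (set T) := [set M | silting M].

Definition silting_object X : Prop := silting (add [set X]).

Definition left_approximation D X Y (f : hom X Y) : Prop :=
  D Y /\ forall Y', D Y' -> forall k : hom X Y',
    exists l : hom Y Y', l \co f = k.

Definition right_approximation D X Y (g : hom Y X) : Prop :=
  D Y /\ forall Y', D Y' -> forall k : hom Y' X,
    exists l : hom Y' Y, g \co l = k.

Definition covariantly_finite D M : Prop :=
  forall X, M X -> exists Y (f : hom X Y), left_approximation D f.

Definition contravariantly_finite D M : Prop :=
  forall X, M X -> exists Y (g : hom Y X), right_approximation D g.

(* [c X] is the chosen object N_X; only its values on M matter. *)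
Definition is_left_mutation M D N : Prop :=
  exists c : T -> T,
    (forall X, M X -> exists Y (f : hom X Y) (g : hom Y (c X))
        (h : hom (c X) (shift X)), left_approximation D f /\ dist f g h) /\
    N = add (D `|` c @` M).

Definition is_right_mutation M D N : Prop :=
  exists c : T -> T,
    (forall X, M X -> exists Y (f : hom (c X) Y) (g : hom Y X)
        (h : hom X (shift (c X))), right_approximation D g /\ dist f g h) /\
    N = add (D `|` c @` M).

Definition iso_class X : set T := [set Y | isomorphic X Y].

Definition ind M : set (set T) := iso_class @` (M `&` @indecomposable T).

Definition removes_one_indecomposable M D : Prop :=
  [/\ subcategory D, D `<=` M & exists c, ind M `\` ind D = [set c]].

Definition irreducible_left_mutation M N : Prop :=
  exists D, [/\ removes_one_indecomposable M D, covariantly_finite D M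
              & is_left_mutation M D N].

Definition irreducible_right_mutation M N : Prop :=
  exists D, [/\ removes_one_indecomposable M D, contravariantly_finite D M
              & is_right_mutation M D N].

(* One step of the action of irreducible mutation on [silt]. *)
Definition irreducible_mutation M N : Prop :=
  [/\ silt M, silt N
    & irreducible_left_mutation M N \/ irreducible_right_mutation M N].

End Silting.

Arguments silt : clear implicits.

(* Main.v *)
From mathcomp Require Import all_boot all_order all_algebra zify.
From mathcomp Require Import boolp classical_sets.
Require Import Defs.

(** Let X be an indecomposable silting object. The silting subcategories of T
    are exactly the additive closures of the shifts X[n], and consecutive ones
    are related by irreducible mutation at the zero subcategory, using the
    triangle X -> 0 -> X[1]. This gives transitivity ([mutation_sh_path]), once
    it is known that every silting subcategory N is the additive closure of some
    X[n] ([silting_classification]).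

    Degrees of nonzero maps between X and N are bounded above ([silting_bound]),
    so there is a shift A of X with no nonzero maps of positive degree from A to
    N, but with a nonzero map from A to some Y0 in N. The point is that there
    are also no nonzero maps of positive degree from N to A. Otherwise take the
    largest i > 0 such that there is a nonzero map from some Y in N to A[i].
    There is a nonzero map from A[i] to Y0[i], and [nonvanishing] produces a
    nonzero map from Y to Y0[i], which contradicts that N is silting. Now an
    object Y of N has no nonzero maps of positive degree to or from A, so that
    its identity factors through a sum of copies of A; thus N is contained in
    add A, and it contains A because a nonzero object of N has a summand with
    local endomorphism ring, which must be A ([silting_eq_add]).

    The lemma [nonvanishing] says: if Y has no nonzero maps of positive degree
    to A, B has no nonzero maps of positive degree from A, and Hom(Y, A) and
    Hom(A, B) are nonzero, then Hom(Y, B) is nonzero. Both groups are finitely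
    generated over the local ring End(A). If Hom(Y, B) = 0, the cone of a map
    from Y to a finite sum of copies of A given by a minimal set of generators
    of Hom(Y, A) shows that Hom(A, B) equals its product with the radical of
    End(A), so it is zero by Nakayama's lemma ([nakayama]).

    Finite generation, and the factorization of maps through sums of copies of
    A, come from [weak_decomposition]. The objects built from shifts of A by
    extensions can be rearranged so that the negative shifts of A come first,
    then the copies of A, then the positive shifts, because triangles in the
    wrong order split ([ext_swap]); every object of T is a retract of such an
    object, and the factorization properties pass to retracts. *)

Set Implicit Arguments.
Unset Strict Implicit.
Unset Printing Implicit Defensive.

Import GRing.Theory Order.TTheory.
Local Open Scope ring_scope.
Local Open Scope classical_set_scope.

(** * Preadditive categories *)

Section PreadditiveTheory.
Variable C : preadditive_cat.
Implicit Types X Y Z W V A B S : C.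

Lemma comp0m X Y Z (f : hom X Y) : (0 : hom Y Z) \co f = 0.
Proof. by apply: (@addrI _ (0 \co f)); rewrite -compDl !addr0. Qed.

Lemma compm0 X Y Z (g : hom Y Z) : g \co (0 : hom X Y) = 0.
Proof. by apply: (@addrI _ (g \co 0)); rewrite -compDr !addr0. Qed.

Lemma compNm X Y Z (g : hom Y Z) (f : hom X Y) : (- g) \co f = - (g \co f).
Proof. by apply: (@addrI _ (g \co f)); rewrite -compDl !subrr comp0m. Qed.

Lemma compmN X Y Z (g : hom Y Z) (f : hom X Y) : g \co (- f) = - (g \co f).
Proof. by apply: (@addrI _ (g \co f)); rewrite -compDr !subrr compm0. Qed.

Lemma compBl X Y Z (g1 g2 : hom Y Z) (f : hom X Y) :
  (g1 - g2) \co f = g1 \co f - g2 \co f.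
Proof. by rewrite compDl compNm. Qed.

Lemma compBr X Y Z (g : hom Y Z) (f1 f2 : hom X Y) :
  g \co (f1 - f2) = g \co f1 - g \co f2.
Proof. by rewrite compDr compmN. Qed.

Lemma comp_suml I (r : seq I) (P : pred I) X Y Z (F : I -> hom Y Z)
    (f : hom X Y) :
  (\sum_(i <- r | P i) F i) \co f = \sum_(i <- r | P i) (F i \co f).
Proof.
exact: (big_morph (fun g => comp g f) (fun _ _ => compDl _ _ _) (comp0m _ _)).
Qed.

Lemma comp_sumr I (r : seq I) (P : pred I) X Y Z (F : I -> hom X Y)
    (g : hom Y Z) :
  g \co (\sum_(i <- r | P i) F i) = \sum_(i <- r | P i) (g \co F i).
Proof. exact: (big_morph (comp g) (fun _ _ => compDr _ _ _) (compm0 _ _)). Qed.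

Lemma zero_objP X : is_zero_obj X <-> idm X = 0.
Proof.
split=> [zX|e Y]; first exact: (zX X).1.
by split=> f; [rewrite -[f]compm1 e compm0 | rewrite -[f]comp1m e comp0m].
Qed.

Lemma zero_obj_from X Y (f : hom X Y) : is_zero_obj X -> f = 0.
Proof. by move=> zX; case: (zX Y). Qed.

Lemma zero_obj_to X Y (f : hom Y X) : is_zero_obj X -> f = 0.
Proof. by move=> zX; case: (zX Y). Qed.

(** Z is a retract of W. *)
Definition retract Z W : Prop :=
  exists (i : hom Z W) (r : hom W Z), r \co i = idm Z.

Lemma isomorphic_sym X Y : isomorphic X Y -> isomorphic Y X.
Proof. by case=> f [g [gf fg]]; exists g, f. Qed.

Lemma isomorphic_refl X : isomorphic X X.
Proof. by exists (idm X), (idm X); rewrite comp1m. Qed.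

Lemma is_iso_comp X Y Z (f : hom X Y) (g : hom Y Z) :
  is_iso f -> is_iso g -> is_iso (g \co f).
Proof.
move=> [f' [f'f ff']] [g' [g'g gg']]; exists (f' \co g').
by rewrite -compA (compA g') g'g comp1m f'f -compA (compA f) ff' comp1m.
Qed.

Lemma isomorphic_trans X Y Z : isomorphic X Y -> isomorphic Y Z ->
  isomorphic X Z.
Proof.
by move=> [f hf] [g hg]; exists (g \co f); exact: is_iso_comp.
Qed.

Lemma isomorphic_retract X Y : isomorphic X Y -> retract X Y.
Proof. by case=> f [g [gf fg]]; exists f, g. Qed.

Lemma zero_obj_retract X Y : retract X Y -> is_zero_obj Y -> is_zero_obj X.
Proof.
by case=> i [r ri] zY; apply/zero_objP; rewrite -ri (zero_obj_to i zY) compm0.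
Qed.

Lemma is_iso_id X : is_iso (idm X).
Proof. by exists (idm X); rewrite comp1m. Qed.

(** The equations of a biproduct: S is the direct sum of X and Y, with
    inclusions i, j and projections p, q. *)
Definition biproduct X Y S (i : hom X S) (j : hom Y S) (p : hom S X)
    (q : hom S Y) : Prop :=
  [/\ p \co i = idm X, q \co j = idm Y, p \co j = 0, q \co i = 0
    & i \co p + j \co q = idm S].

Lemma biproduct_coproduct X Y S (i : hom X S) (j : hom Y S) p q :
  biproduct i j p q -> is_binary_coproduct i j.
Proof.
case=> pi qj pj qi e Z f g; exists (f \co p + g \co q); split.
  by rewrite !compDl -!compA pi qj pj qi !compm1 !compm0 addr0 add0r.
by move=> h [<- <-]; rewrite -!compA -compDr e compm1.
Qed.

Lemma coproduct_biproduct X Y S (i : hom X S) (j : hom Y S) :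
  is_binary_coproduct i j -> exists p q, biproduct i j p q.
Proof.
move=> u; have [p [[pi pj] _]] := u X (idm X) 0.
have [q [[qi qj] _]] := u Y 0 (idm Y).
exists p, q; split=> //; have [k [_ uk]] := u S i j.
rewrite -(uk (idm S)) ?comp1m // (uk (i \co p + j \co q)) //.
by rewrite !compDl -!compA pi qj pj qi !compm1 !compm0 addr0 add0r.
Qed.

Lemma coproduct_projections n (F : 'I_n -> C) S (inj : forall i, hom (F i) S) :
  is_coproduct inj -> exists proj : forall i, hom S (F i),
    [/\ forall i, proj i \co inj i = idm (F i),
        forall i j, i != j -> proj i \co inj j = 0
      & \sum_i (inj i \co proj i) = idm S].
Proof.
move=> u.
have ex i : exists p : hom S (F i),
    p \co inj i = idm (F i) /\ forall j, i != j -> p \co inj j = 0.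
  (* the Kronecker delta, transported along the equality of indices *)
  pose d j : hom (F j) (F i) :=
    if @eqP _ j i is ReflectT e then ecast k (hom (F j) (F k)) e (idm (F j))
    else 0.
  have [p [hp _]] := u _ d; exists p; split.
    by rewrite hp /d; case: eqP => // e; rewrite eq_axiomK.
  by move=> j ij; rewrite hp /d; case: eqP => // e; rewrite e eqxx in ij.
pose proj i := sval (cid (ex i)).
have pi i : proj i \co inj i = idm (F i) by case: (svalP (cid (ex i))).
have pj i j : i != j -> proj i \co inj j = 0.
  by case: (svalP (cid (ex i))) => _; apply.
exists proj; split=> //.
have [k [_ uk]] := u S inj; rewrite -(uk (idm S)) => [|i]; last exact: comp1m.
symmetry; apply: uk => i; rewrite comp_suml (bigD1 i) //= -compA pi compm1 big1.
  by rewrite addr0.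
by move=> j ji; rewrite -compA pj // compm0.
Qed.

(** ** Finite sums of copies of an object *)

(** The maps that factor through a finite direct sum of copies of A: a two-sided
    ideal of the category. *)
Definition factors A X Y (f : hom X Y) : Prop :=
  exists l : seq (hom A Y * hom X A), f = \sum_(x <- l) (x.1 \co x.2).

(** The retracts of finite direct sums of copies of A, recognized by their
    identity map. *)
Definition rsum A : set C := [set X | factors A (idm X)].

Lemma factors0 A X Y : factors A (0 : hom X Y).
Proof. by exists [::]; rewrite big_nil. Qed.

Lemma factorsD A X Y (f g : hom X Y) :
  factors A f -> factors A g -> factors A (f + g).
Proof. by case=> l -> [l' ->]; exists (l ++ l'); rewrite big_cat. Qed.

Lemma factors_sum A X Y I (r : seq I) (F : I -> hom X Y) :
  (forall i, factors A (F i)) -> factors A (\sum_(i <- r) F i).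
Proof.
by move=> h; apply: big_ind => *; [apply: factors0 | apply: factorsD |].
Qed.

Lemma factors_comp A X Y Z W (f : hom X Y) (g : hom Y Z) (h : hom Z W) :
  factors A g -> factors A (h \co g \co f).
Proof.
case=> l ->; exists [seq (h \co x.1, x.2 \co f) | x <- l].
by rewrite big_map comp_sumr comp_suml; apply: eq_bigr => x _; rewrite !compA.
Qed.

Lemma rsum_refl A : rsum A A.
Proof. by exists [:: (idm A, idm A)]; rewrite big_seq1 comp1m. Qed.

Lemma rsum_retract A X Y : retract X Y -> rsum A Y -> rsum A X.
Proof.
by case=> i [r ri] /(factors_comp i r); rewrite compm1 ri.
Qed.

Lemma rsum_zero A X : is_zero_obj X -> rsum A X.
Proof. by move/zero_objP => e; rewrite /rsum /= e; apply: factors0. Qed.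

Lemma rsum_biproduct A X Y S (i : hom X S) (j : hom Y S) p q :
  biproduct i j p q -> rsum A X -> rsum A Y -> rsum A S.
Proof.
case=> _ _ _ _ e rX rY; rewrite /rsum /= -e -[i]compm1 -[j]compm1.
by apply: factorsD; apply: factors_comp.
Qed.

Lemma rsum_iso A X Y : isomorphic X Y -> rsum A X -> rsum A Y.
Proof. by move/isomorphic_sym/isomorphic_retract/rsum_retract; apply. Qed.

Lemma rsum_vanish_from A X V : (forall f : hom A V, f = 0) -> rsum A X ->
  forall f : hom X V, f = 0.
Proof.
move=> h [l e] f; rewrite -[f]compm1 e comp_sumr big1 // => x _.
by rewrite compA (h (f \co x.1)) comp0m.
Qed.

Lemma rsum_vanish_to A X V : (forall f : hom V A, f = 0) -> rsum A X ->
  forall f : hom V X, f = 0.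
Proof.
move=> h [l e] f; rewrite -[f]comp1m e comp_suml big1 // => x _.
by rewrite -compA (h (x.2 \co f)) compm0.
Qed.

(** ** Local endomorphism rings *)

Lemma not_iso0 X : idm X <> 0 -> ~ is_iso (0 : hom X X).
Proof. by move=> nz [g [e _]]; apply: nz; rewrite -e compm0. Qed.

Lemma local_sum X I (r : seq I) (F : I -> hom X X) : local_ring (End X) ->
  (forall i, ~ is_iso (F i)) -> ~ is_iso (\sum_(i <- r) F i).
Proof.
case=> nz hD h; apply: (big_ind (fun f => ~ is_iso f)) => //.
exact: not_iso0.
Qed.

(** In a local ring, a one-sided inverse is two-sided: otherwise the idempotents
    ab and 1 - ab would be two nonunits with sum 1. *)
Lemma local_left_inverse X (a b : hom X X) : local_ring (End X) ->
  b \co a = idm X -> a \co b = idm X.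
Proof.
case=> nz hD ba.
have nz' : idm X <> 0 := nz.
have hD' (u v : hom X X) :
  ~ is_iso u -> ~ is_iso v -> ~ is_iso (u + v) := hD u v.
have iab : (a \co b) \co (a \co b) = a \co b.
  by rewrite -compA (compA b) ba comp1m.
have idem (e : hom X X) : e \co e = e -> is_iso e -> e = idm X.
  by move=> ee [g [ge _]]; rewrite -ge -{2}ee compA ge comp1m.
case: (pselect (is_iso (a \co b))) => [/idem -> //|n1].
case: (pselect (is_iso (idm X - a \co b))) => [n2|n2].
  have e : idm X - a \co b = idm X.
    apply: idem => //.
    by rewrite compBl !compBr !comp1m !compm1 iab subrr subr0.
  have ab0 : a \co b = 0 by rewrite -[LHS](subKr (idm X)) e subrr.
  case: nz'; rewrite -[LHS](comp1m) -{1}ba -{1}ba -compA (compA a) ab0.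
  by rewrite comp0m compm0.
case: (hD' _ _ n1 n2); rewrite addrC subrK; exact: is_iso_id.
Qed.

Lemma local_nonunit_comp X (c e : hom X X) : local_ring (End X) ->
  ~ is_iso e -> ~ is_iso (c \co e).
Proof.
move=> lX ne [g [gce _]]; apply: ne; exists (g \co c).
have h : (g \co c) \co e = idm X by rewrite -compA.
by split=> //; apply: local_left_inverse.
Qed.

Lemma local_sub_nonunit X (e : hom X X) : local_ring (End X) ->
  ~ is_iso e -> is_iso (idm X - e).
Proof.
move=> lX ne; apply: contrapT => n1.
have [_ hD] := lX; case: (hD _ _ n1 ne).
by have : is_iso (idm X - e + e) by rewrite subrK; exact: is_iso_id.
Qed.

Lemma local_not_zero X : local_ring (End X) -> ~ is_zero_obj X.
Proof. by case=> nz _ /zero_objP; exact: nz. Qed.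

Lemma rsum_local A X : local_ring (End X) -> rsum A X -> retract X A.
Proof.
move=> lX [l e]; apply: contrapT => nr.
suff : ~ is_iso (idm X) by case; exact: is_iso_id.
rewrite e; apply: local_sum => // -[u v] /= [g [guv _]].
by apply: nr; exists v, (g \co u); rewrite -compA.
Qed.

(** A version of Nakayama's lemma: Hom(A, B) vanishes if it is finitely
    generated over the local ring End(A) and equal to its product with the
    radical. *)
Lemma nakayama A B n (h : 'I_n -> hom A B) : local_ring (End A) ->
  (forall f : hom A B, exists c : 'I_n -> hom A A, f = \sum_i (h i \co c i)) ->
  (forall f : hom A B, exists (m : nat) (k : 'I_m -> hom A B)
      (e : 'I_m -> hom A A),
      (forall j, ~ is_iso (e j)) /\ f = \sum_j (k j \co e j)) ->
  forall f : hom A B, f = 0.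
Proof.
move=> lA gen rad; elim: n h gen => [|n IH] h gen.
  by move=> f; have [c ->] := gen f; rewrite big_ord0.
have [m [k [e [ne eh]]]] := rad (h ord0).
have [c hc] := choice (fun j => gen (k j)).
pose d i := \sum_j (c j i \co e j).
have hd : h ord0 = \sum_i (h i \co d i).
  rewrite eh; under eq_bigr => j _ do rewrite hc comp_suml.
  rewrite exchange_big /=; apply: eq_bigr => i _.
  by rewrite comp_sumr; apply: eq_bigr => j _; rewrite compA.
have [g [_ dg]] : is_iso (idm A - d ord0).
  apply: local_sub_nonunit => //; apply: local_sum => // j.
  exact: local_nonunit_comp.
(* as 1 - d_0 is invertible, the generator h_0 is redundant *)
have h0 : h ord0 = \sum_i (h (lift ord0 i) \co (d (lift ord0 i) \co g)).
  have e0 : h ord0 \co (idm A - d ord0) =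
      \sum_i (h (lift ord0 i) \co d (lift ord0 i)).
    by rewrite compBr compm1 {1}hd big_ord_recl addrAC subrr add0r.
  rewrite -[LHS]compm1 -dg compA e0 comp_suml.
  by apply: eq_bigr => i _; rewrite compA.
apply: (IH (fun i => h (lift ord0 i))) => f; have [a ->] := gen f.
exists (fun i => d (lift ord0 i) \co g \co a ord0 + a (lift ord0 i)).
rewrite big_ord_recl {1}h0 comp_suml -big_split; apply: eq_bigr => i _ /=.
by rewrite compDr !compA.
Qed.

End PreadditiveTheory.

(** * Additive functors *)

Section Functors.
Variables (C D : preadditive_cat) (F : additive_functor C D).
Implicit Types X Y Z S A : C.

Lemma fmap0 X Y : fmap F (0 : hom X Y) = 0.
Proof. by apply: (@addrI _ (fmap F 0)); rewrite -fmapD !addr0. Qed.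

Lemma fmapN X Y (f : hom X Y) : fmap F (- f) = - fmap F f.
Proof. by apply: (@addrI _ (fmap F f)); rewrite -fmapD !subrr fmap0. Qed.

Lemma fmap_sum I (r : seq I) X Y (f : I -> hom X Y) :
  fmap F (\sum_(i <- r) f i) = \sum_(i <- r) fmap F (f i).
Proof. exact: (big_morph (fmap F) (fun _ _ => fmapD _ _ _) (fmap0 _ _)). Qed.

Lemma fmap_is_iso X Y (f : hom X Y) : is_iso f -> is_iso (fmap F f).
Proof.
by case=> g [gf fg]; exists (fmap F g); rewrite -!fmap_comp gf fg !fmap1.
Qed.

Lemma fmap_isomorphic X Y : isomorphic X Y -> isomorphic (F X) (F Y).
Proof. by case=> f /fmap_is_iso; exists (fmap F f). Qed.

Lemma fmap_retract X Y : retract X Y -> retract (F X) (F Y).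
Proof.
by case=> i [r ri]; exists (fmap F i), (fmap F r); rewrite -fmap_comp ri fmap1.
Qed.

Lemma fmap_zero_obj X : is_zero_obj X -> is_zero_obj (F X).
Proof. by move/zero_objP => e; apply/zero_objP; rewrite -fmap1 e fmap0. Qed.

Lemma fmap_biproduct X Y S (i : hom X S) (j : hom Y S) p q :
  biproduct i j p q ->
  biproduct (fmap F i) (fmap F j) (fmap F p) (fmap F q).
Proof.
case=> pi qj pj qi e; split; rewrite -?fmap_comp -?fmapD ?e ?fmap1 //.
- by rewrite pi fmap1.
- by rewrite qj fmap1.
- by rewrite pj fmap0.
- by rewrite qi fmap0.
Qed.

Lemma fmap_rsum A X : rsum A X -> rsum (F A) (F X).
Proof.
case=> l e; exists [seq (fmap F x.1, fmap F x.2) | x <- l].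
rewrite big_map -fmap1 e fmap_sum; apply: eq_bigr => x _.
by rewrite fmap_comp.
Qed.

End Functors.

(** * Triangles *)

Section Triangles.
Variable T : triangulated_cat.
Implicit Types X Y Z W V A B S : T.

Lemma unshift_shift_iso X : isomorphic (unshift (shift X)) X.
Proof. by have [e [ei _]] := unshift_shift T; exists (e X). Qed.

Lemma shift_unshift_iso X : isomorphic (shift (unshift X)) X.
Proof. by have [e [ei _]] := shift_unshift T; exists (e X). Qed.

Lemma shift_faithful X Y (f g : hom X Y) :
  fmap shift f = fmap shift g -> f = g.
Proof.
have [e [ei en]] := unshift_shift T; move=> fg.
have [e' [_ ee']] := ei X.
by rewrite -[f]compm1 -[g]compm1 -ee' !compA !en fg.
Qed.

Lemma unshift_faithful X Y (f g : hom X Y) :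
  fmap unshift f = fmap unshift g -> f = g.
Proof.
have [e [ei en]] := shift_unshift T; move=> fg.
have [e' [_ ee']] := ei X.
by rewrite -[f]compm1 -[g]compm1 -ee' !compA !en fg.
Qed.

Lemma shift_full X Y (k : hom (shift X) (shift Y)) :
  exists f : hom X Y, fmap shift f = k.
Proof.
have [e [ei en]] := unshift_shift T.
have [e' [e'e ee']] := ei X; have [d [de ed]] := ei Y.
exists (e Y \co fmap unshift k \co e').
apply: unshift_faithful.
rewrite -[LHS]comp1m -de -compA -en -!compA e'e compm1 compA de.
by rewrite comp1m.
Qed.

Lemma shift_zero_obj X : is_zero_obj (shift X) -> is_zero_obj X.
Proof.
move/zero_objP => e; apply/zero_objP/shift_faithful.
by rewrite fmap1 e fmap0.
Qed.

Lemma unshift_zero_obj X : is_zero_obj (unshift X) -> is_zero_obj X.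
Proof.
move/zero_objP => e; apply/zero_objP/unshift_faithful.
by rewrite fmap1 e fmap0.
Qed.

Lemma zero_obj_exists : exists O : T, is_zero_obj O.
Proof.
pose F (i : 'I_0) : T := match i with Ordinal _ h => match notF h with end end.
have [O [inj u]] := has_coproducts F; exists O; apply/zero_objP.
have [k [_ uk]] := u O inj.
by rewrite -(uk (idm O)) => [|[]//]; apply: uk => -[].
Qed.

Lemma dist_rot X Y Z (f : hom X Y) (g : hom Y Z) (h : hom Z (shift X)) :
  dist f g h -> dist g h (- fmap shift f).
Proof. by move/dist_rotate. Qed.

Lemma dist_shift X Y Z (f : hom X Y) (g : hom Y Z) (h : hom Z (shift X)) :
  dist f g h ->
  dist (- fmap shift f) (- fmap shift g) (- fmap shift h).
Proof. by move=> d; do 3! apply: dist_rot. Qed.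

Lemma dist_comp0 X Y Z (f : hom X Y) (g : hom Y Z) (h : hom Z (shift X)) :
  dist f g h -> g \co f = 0.
Proof.
move=> d; have [O zO] := zero_obj_exists.
have [|c [e _]] := dist_morphism (dist_id X zO) d (a := idm X) (b := f).
  by rewrite !compm1.
by rewrite -e compm0.
Qed.

(** In a triangle X -> Y -> Z -> X[1], the map X -> Y is a weak kernel of Y ->
    Z, and the map Y -> Z is a weak cokernel of X -> Y. *)
Lemma dist_weak_kernel X Y Z W (f : hom X Y) (g : hom Y Z)
    (h : hom Z (shift X)) (k : hom W Y) :
  dist f g h -> g \co k = 0 -> exists k', k = f \co k'.
Proof.
move=> d gk; have [O zO] := zero_obj_exists.
have [|c [_ e]] := dist_morphism (dist_rot (dist_id W zO)) (dist_rot d)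
  (a := k) (b := 0); first by rewrite gk comp0m.
have [k' ek] := shift_full c; exists k'; apply: shift_faithful.
move: e; rewrite fmap1 -ek compmN compm1 compNm -fmap_comp => e.
exact: oppr_inj.
Qed.

Lemma dist_weak_cokernel X Y Z W (f : hom X Y) (g : hom Y Z)
    (h : hom Z (shift X)) (k : hom Y W) :
  dist f g h -> k \co f = 0 -> exists k', k = k' \co g.
Proof.
move=> d kf; have [O zO] := zero_obj_exists.
have d0 : dist (0 : hom O W) (idm W) (0 : hom W (shift O)).
  apply/dist_rotate; rewrite fmap0 oppr0.
  by apply: dist_id; apply: fmap_zero_obj.
have [|c [e _]] := dist_morphism d d0 (a := 0) (b := k).
  by rewrite kf comp0m.
by exists c; rewrite e comp1m.
Qed.

(** Rotation of a triangle to the left. As the suspension is only an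
    equivalence, the maps g and h are recovered up to the isomorphism e. *)
Lemma dist_unrotate X Y Z (f : hom X Y) (g : hom Y Z) (h : hom Z (shift X)) :
  dist f g h ->
  exists (f' : hom (unshift Z) X) (e : hom (shift (unshift Z)) Z)
      (g' : hom Y (shift (unshift Z))),
    [/\ dist f' f g', is_iso e, h \co e = - fmap shift f' & e \co g' = g].
Proof.
move=> d; have [e [ei _]] := shift_unshift T.
have [e' [e'e ee']] := ei Z.
have [w hw] := shift_full (h \co e Z).
exists (- w), (e Z), (e' \co g); split=> //; last first.
- by rewrite compA ee' comp1m.
- by rewrite fmapN opprK hw.
apply/dist_rotate; rewrite fmapN opprK hw.
apply: (dist_iso (is_iso_id X) (is_iso_id Y) (_ : is_iso e') _ _ _ d).
- by exists (e Z).
- by rewrite comp1m compm1.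
- by rewrite compm1.
- by rewrite fmap1 comp1m -compA ee' compm1.
Qed.

Lemma dist_replace X Y Z X' Y' Z' (f : hom X Y) (g : hom Y Z)
    (h : hom Z (shift X)) :
  isomorphic X X' -> isomorphic Y Y' -> isomorphic Z Z' -> dist f g h ->
  exists (f' : hom X' Y') g' h', dist (Z := Z') f' g' h'.
Proof.
move=> [a ia] [b ib] [c ic] d.
have [a' [a'a aa']] := ia; have [b' [b'b bb']] := ib.
have [c' [c'c cc']] := ic.
exists (b \co f \co a'), (c \co g \co b'), (fmap shift a \co h \co c').
apply: (dist_iso ia ib ic _ _ _ d); rewrite -!compA.
- by rewrite a'a compm1.
- by rewrite b'b compm1.
- by rewrite c'c compm1.
Qed.

(** A triangle whose connecting map vanishes is split. *)
Lemma dist_split X Y Z (f : hom X Y) (g : hom Y Z) :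
  dist f g 0 -> exists s r, biproduct f s r g.
Proof.
move=> d; have gf := dist_comp0 d.
have [s gs] : exists s, idm Z = g \co s.
  by apply: (dist_weak_kernel (dist_rot d)); rewrite comp0m.
have [f' [e [g' [d' _ h' _]]]] := dist_unrotate d.
have f'0 : f' = 0.
  by apply: shift_faithful; apply: oppr_inj; rewrite -h' comp0m fmap0 oppr0.
have [r0 r0f] : exists r, idm X = r \co f.
  by apply: (dist_weak_cokernel d'); rewrite f'0 compm0.
(* correct the retraction so that it kills the section s *)
pose r := r0 - r0 \co s \co g.
have rf : r \co f = idm X by rewrite compBl -compA gf compm0 subr0 -r0f.
have rs : r \co s = 0 by rewrite compBl -!compA -gs compm1 subrr.
clearbody r; exists s, r; split=> //.
have [w ew] : exists w, idm Y - f \co r - s \co g = f \co w.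
  apply: (dist_weak_kernel d).
  by rewrite !compBr compm1 !compA gf comp0m -gs comp1m subr0 subrr.
have w0 : w = 0.
  rewrite -[w]comp1m -rf -compA -ew !compBr compm1 !compA rf rs comp1m comp0m.
  by rewrite subr0 subrr.
move: ew; rewrite w0 compm0 => /eqP.
by rewrite subr_eq0 subr_eq addrC => /eqP ->.
Qed.

Lemma dist_split_mono X Y Z (f : hom X Y) (g : hom Y Z) (h : hom Z (shift X))
    (r : hom Y X) :
  dist f g h -> r \co f = idm X -> h = 0.
Proof.
move=> d rf; have e : fmap shift f \co h = 0.
  apply: oppr_inj; rewrite -compNm oppr0.
  exact: (dist_comp0 (dist_rot (dist_rot d))).
by rewrite -[h]comp1m -fmap1 -rf fmap_comp -compA e compm0.
Qed.

(** Retracts are direct summands. *)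
Lemma retract_biproduct X Y (i : hom X Y) (r : hom Y X) : r \co i = idm X ->
  exists Z (j : hom Z Y) p q, biproduct i j p q.
Proof.
move=> ri; have [Z [g [h d]]] := dist_cone i.
have h0 := dist_split_mono d ri; rewrite h0 in d.
have [s [p b]] := dist_split d.
by exists Z, s, p, g.
Qed.

Lemma biproduct_dist X Y S (i : hom X S) (j : hom Y S) p q :
  biproduct i j p q -> dist i q 0.
Proof.
case=> pi qj pj qi e; have [Z [g [h d]]] := dist_cone i.
have h0 := dist_split_mono d pi; rewrite h0 in d.
have gi := dist_comp0 d.
have [c ec] := dist_weak_cokernel d qi.
have cgj : c \co (g \co j) = idm Y by rewrite compA -ec.
have gjc : (g \co j) \co c = idm Z.
  have [k ek] : exists k, g \co j \co c - idm Z = k \co (0 : hom Z (shift X)).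
    apply: (dist_weak_cokernel (dist_rot d)).
    rewrite compBl comp1m -!compA -ec -[X in _ - X]compm1 -e compDr.
    by rewrite (compA g i) gi comp0m add0r subrr.
  by apply/eqP; rewrite -subr_eq0 ek compm0.
have ic : is_iso c by exists (g \co j).
apply: (dist_iso (is_iso_id X) (is_iso_id S) ic _ _ _ d).
- by rewrite comp1m compm1.
- by rewrite compm1.
- by rewrite compm0 comp0m.
Qed.

Lemma biproduct_sym X Y S (i : hom X S) (j : hom Y S) p q :
  biproduct i j p q -> biproduct j i q p.
Proof. by case=> pi qj pj qi e; split=> //; rewrite addrC. Qed.

(** An endomorphism of a triangle that is the identity on two terms is
    invertible on the third, being the identity plus a map of square zero. *)
Lemma dist_endo_iso X Y Z (f : hom X Y) (g : hom Y Z) (h : hom Z (shift X))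
    (u : hom Z Z) :
  dist f g h -> u \co g = g -> h \co u = h -> is_iso u.
Proof.
move=> d ug hu.
have [v ev] : exists v, u - idm Z = v \co h.
  by apply: (dist_weak_cokernel (dist_rot d)); rewrite compBl comp1m ug subrr.
pose n := u - idm Z.
have nn : n \co n = 0.
  by rewrite {1}/n ev -compA /n compBr compm1 hu subrr compm0.
have -> : u = idm Z + n by rewrite /n addrC subrK.
clearbody n; exists (idm Z - n); split.
  by rewrite compBl !compDr !comp1m !compm1 nn addr0 addrK.
by rewrite compDl !compBr !comp1m !compm1 nn subr0 subrK.
Qed.

(** ** Extensions of classes of objects *)

(** The class written P * Q: the middle terms of triangles whose outer terms lie
    in P and Q. *)
Definition ext (P Q : set T) : set T :=
  [set Y | exists X Z (f : hom X Y) (g : hom Y Z) (h : hom Z (shift X)),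
    [/\ P X, Q Z & dist f g h]].

Lemma ext_mono (P P' Q Q' : set T) : P `<=` P' -> Q `<=` Q' ->
  ext P Q `<=` ext P' Q'.
Proof.
move=> hP hQ Y [X [Z [f [g [h [pX qZ d]]]]]].
by exists X, Z, f, g, h; split=> //; [exact: hP | exact: hQ].
Qed.

(** The two halves of associativity of extensions; both are the octahedral
    axiom. *)
Lemma ext_assoc_r (P Q R : set T) : ext (ext P Q) R `<=` ext P (ext Q R).
Proof.
move=> Y [Y' [R' [g [g1 [g2 [[X [Q' [f [f1 [f2 [pX qQ df]]]]]] rR dg]]]]]].
have [C [h1 [h2 dh]]] := dist_cone (g \co f).
have [u [v [duv _ _ _ _]]] := dist_octahedron df dg dh.
exists X, C, (g \co f), h1, h2; split=> //.
by exists Q', R', u, v, (fmap shift f1 \co g2); split.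
Qed.

Lemma ext_assoc_l (P Q R : set T) : ext P (ext Q R) `<=` ext (ext P Q) R.
Proof.
move=> Y [X [C [a [f [b [pX [Q' [R' [c [g [k [qQ rR dc]]]]]] da]]]]]].
have [C' [h1 [h2 dh]]] := dist_cone (g \co f).
have [u [v [duv _ _ _ _]]] := dist_octahedron (dist_rot da) (dist_rot dc) dh.
(* the cone C' of Y -> R' is an extension of Q'[1] by X[1]: rotate back *)
have [x1 [_ [x2 [d1 _ _ _]]]] := dist_unrotate dh.
have [y1 [_ [y2 [e1 _ _ _]]]] := dist_unrotate duv.
have [y1' [_ [y2' [e2 _ _ _]]]] := dist_unrotate e1.
have [y1'' [_ [y2'' [e3 _ _ _]]]] := dist_unrotate e2.
have [z1 [z2 [z3 d3]]] := dist_replace (unshift_shift_iso X)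
  (isomorphic_refl _) (unshift_shift_iso Q') e3.
exists (unshift C'), R', x1, (g \co f), x2; split=> //.
by exists X, Q', z1, z2, z3.
Qed.

(** If there is no nonzero map from Q to P[1], the triangles defining P * Q
    split, so the factors can be exchanged. *)
Lemma ext_swap (P Q : set T) :
  (forall X Z, P X -> Q Z -> forall h : hom Z (shift X), h = 0) ->
  ext P Q `<=` ext Q P.
Proof.
move=> v Y [X [Z [f [g [h [pX qZ d]]]]]].
rewrite (v X Z pX qZ h) in d; have [s [r b]] := dist_split d.
exists Z, X, s, r, 0; split=> //; exact: biproduct_dist (biproduct_sym b).
Qed.

Lemma ext_left (P Q : set T) : (forall O, is_zero_obj O -> Q O) ->
  P `<=` ext P Q.
Proof.
move=> hO X pX; have [O zO] := zero_obj_exists.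
exists X, O, (idm X), 0, 0; split=> //; [exact: hO | exact: dist_id].
Qed.

Lemma ext_right (P Q : set T) : (forall O, is_zero_obj O -> P O) ->
  Q `<=` ext P Q.
Proof.
move=> hO X qX; have [O zO] := zero_obj_exists.
exists O, X, 0, (idm X), 0; split=> //; first exact: hO.
apply/dist_rotate; rewrite fmap0 oppr0; apply: dist_id.
exact: fmap_zero_obj.
Qed.

(** ** Recognizing thick subcategories *)

(** A class closed under extensions is closed under finite coproducts: split off
    the first summand. *)
Lemma ext_closed_coproduct (P : set T) :
  (forall X Y, isomorphic X Y -> P X -> P Y) ->
  (forall O, is_zero_obj O -> P O) -> ext P P `<=` P ->
  forall n (F : 'I_n -> T) S (inj : forall i, hom (F i) S),
    is_coproduct inj -> (forall i, P (F i)) -> P S.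
Proof.
move=> Piso P0 Pext; elim=> [|n IH] F S inj u PF.
  apply: P0; apply/zero_objP; have [k [_ uk]] := u S inj.
  by rewrite -(uk (idm S)) => [|[]//]; apply: uk => -[].
have [pr [pi pj e]] := coproduct_projections u.
have [Z [j [p [q b]]]] := retract_biproduct (pi ord0).
have [pi' qj pj' qi' e'] := b.
apply: Pext; exists (F ord0), Z, (inj ord0), q, 0; split=> //; last first.
  exact: biproduct_dist b.
apply: (IH (fun i => F (lift ord0 i)) Z (fun i => q \co inj (lift ord0 i))).
  move=> W f.
  (* extend the family f by zero to the first index *)
  pose f1 (i : 'I_n.+1) : hom (F i) W :=
    match unliftP ord0 i with
    | UnliftSome j e => ecast k (hom (F k) W) (esym e) (f j)
    | UnliftNone e => 0
    end.
  have f1E i : f1 (lift ord0 i) = f i.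
    rewrite /f1; case: unliftP => [k ek|ek].
      have ki := lift_inj ek; move: ek; rewrite -ki => ek.
      by rewrite eq_axiomK.
    by exfalso; move: (neq_lift ord0 i); rewrite ek eqxx.
  have f10 : f1 ord0 = 0.
    rewrite /f1; case: unliftP => [k ek|//]; exfalso.
    by move: (neq_lift ord0 k); rewrite -ek eqxx.
  have [k [hk uk]] := u W f1; exists (k \co j); split.
    move=> i; rewrite -compA (compA j).
    have -> : j \co q = idm S - inj ord0 \co p by rewrite -e' addrC addKr.
    by rewrite compBl comp1m compBr -compA (compA k) !hk f10 comp0m subr0 f1E.
  move=> k' hk'.
  have -> : k = k' \co q.
    apply: uk => i; case: (unliftP ord0 i) => [i' ->|->].
      by rewrite -compA hk' f1E.
    by rewrite -compA qi' compm0 f10.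
  by rewrite -compA qj compm1.
by move=> i; apply: PF.
Qed.

(** Closure under retracts and cones suffices for thickness; closure under
    isomorphisms, finite coproducts and summands is automatic. *)
Lemma thick_criterion (P : set T) :
  (forall O, is_zero_obj O -> P O) ->
  (forall X Y, retract X Y -> P Y -> P X) ->
  (forall X, P X -> P (shift X)) -> (forall X, P X -> P (unshift X)) ->
  (forall X Y Z (f : hom X Y) (g : hom Y Z) (h : hom Z (shift X)),
    dist f g h -> P X -> P Y -> P Z) ->
  thick P.
Proof.
move=> P0 Pr Ps Pu Pc; split=> //.
have Piso X Y : isomorphic X Y -> P X -> P Y.
  by move/isomorphic_sym/isomorphic_retract/Pr; apply.
split=> //; last first.
  move=> X Y S i j /coproduct_biproduct [p [q [pi _ _ _ _]]]; apply: Pr.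
  by exists i, p.
apply: ext_closed_coproduct => // Y [X [Z [f [g [h [pX pZ d]]]]]].
have [f' [_ [g' [d' _ _ _]]]] := dist_unrotate d.
by apply: Pc d' _ pX; apply: Pu.
Qed.

Lemma subcategory_retract (P : set T) X Y :
  subcategory P -> retract X Y -> P Y -> P X.
Proof.
case=> _ _ h [i [r /retract_biproduct [Z [j [p [q /biproduct_coproduct b]]]]]].
exact: h b.
Qed.

End Triangles.

(** * Shifts by integers and vanishing of graded maps *)

Section IntegerShift.
Variable T : triangulated_cat.
Implicit Types X Y Z W V A B : T.

(** The n-fold shift X[n]. *)
Definition sh (n : int) X : T :=
  match n with
  | Posz m => iter m shift X
  | Negz m => iter m.+1 unshift X
  end.

Lemma sh_iso n X Y : isomorphic X Y -> isomorphic (sh n X) (sh n Y).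
Proof.
by case: n => n h; elim: n => [|n IH] //=; try exact: fmap_isomorphic.
Qed.

Lemma shift_sh n X : isomorphic (shift (sh n X)) (sh (n + 1) X).
Proof.
case: n => [n|[|n]]; first by rewrite -PoszD addn1; exact: isomorphic_refl.
  exact: shift_unshift_iso.
have -> : Negz n.+1 + 1 = Negz n by rewrite !NegzE; lia.
exact: shift_unshift_iso.
Qed.

Lemma unshift_sh n X : isomorphic (unshift (sh n X)) (sh (n - 1) X).
Proof.
have h := fmap_isomorphic unshift (shift_sh (n - 1) X).
rewrite subrK in h.
exact: isomorphic_trans (isomorphic_sym h) (unshift_shift_iso _).
Qed.

Lemma int_step_ind (P : int -> Prop) : P 0 ->
  (forall n, P n -> P (n + 1)) -> (forall n, P n -> P (n - 1)) -> forall n, P n.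
Proof.
move=> h0 hS hP [n|n].
  by elim: n => // n /hS; rewrite -PoszD addn1.
elim: n => [|n /hP]; first exact: hP h0.
by congr P; rewrite !NegzE; lia.
Qed.

Lemma sh_add m n X : isomorphic (sh m (sh n X)) (sh (m + n) X).
Proof.
elim/int_step_ind: m => [|m IH|m IH].
- by rewrite add0r; exact: isomorphic_refl.
- apply: isomorphic_trans (isomorphic_sym (shift_sh _ _)) _.
  apply: isomorphic_trans (fmap_isomorphic _ IH) _.
  by rewrite addrAC; exact: shift_sh.
- apply: isomorphic_trans (isomorphic_sym (unshift_sh _ _)) _.
  apply: isomorphic_trans (fmap_isomorphic _ IH) _.
  by rewrite addrAC; exact: unshift_sh.
Qed.

(** All maps of degree n from X to Y vanish. *)
Definition vanish X Y (n : int) : Prop := forall f : hom X (sh n Y), f = 0.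

Lemma hom_vanish_iso X X' Y Y' : isomorphic X X' -> isomorphic Y Y' ->
  (forall f : hom X Y, f = 0) -> forall f : hom X' Y', f = 0.
Proof.
move=> [a [a' [a'a aa']]] [b [b' [b'b bb']]] h f.
have -> : f = b \co (b' \co f \co a) \co a'.
  by rewrite !compA bb' comp1m -compA aa' compm1.
by rewrite (h (b' \co f \co a)) compm0 comp0m.
Qed.

Lemma vanish_iso X X' Y Y' n : isomorphic X X' -> isomorphic Y Y' ->
  vanish X Y n -> vanish X' Y' n.
Proof. by move=> hX hY; apply: hom_vanish_iso => //; exact: sh_iso. Qed.

Lemma vanish_shr X Y m n : vanish X (sh m Y) n <-> vanish X Y (n + m).
Proof.
split; apply: hom_vanish_iso; try exact: isomorphic_refl.
  exact: sh_add.
exact: isomorphic_sym (sh_add _ _ _).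
Qed.

Lemma vanish_shift X Y n : vanish (shift X) Y (n + 1) <-> vanish X Y n.
Proof.
have v1 : vanish (shift X) Y (n + 1) <->
    forall f : hom (shift X) (shift (sh n Y)), f = 0.
  split; apply: hom_vanish_iso; try exact: isomorphic_refl.
    exact: isomorphic_sym (shift_sh _ _).
  exact: shift_sh.
rewrite v1; split=> h f.
  by apply: shift_faithful; rewrite fmap0; exact: h.
by have [k <-] := shift_full f; rewrite (h k) fmap0.
Qed.

Lemma vanish_unshift X Y n : vanish (unshift X) Y n <-> vanish X Y (n + 1).
Proof.
rewrite -vanish_shift; split; apply: vanish_iso; try exact: isomorphic_refl.
  exact: shift_unshift_iso.
exact: isomorphic_sym (shift_unshift_iso _).
Qed.

Lemma vanish_shl X Y m n : vanish (sh m X) Y n <-> vanish X Y (n - m).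
Proof.
elim/int_step_ind: m n => [|m IH|m IH] n; first by rewrite subr0.
  have e : n = (n - 1) + 1 by rewrite subrK.
  transitivity (vanish (shift (sh m X)) Y n).
    by split; apply: vanish_iso; try exact: isomorphic_refl;
      [apply: isomorphic_sym|]; exact: shift_sh.
  by rewrite {1}e vanish_shift IH addrAC opprD addrA.
transitivity (vanish (unshift (sh m X)) Y n).
  by split; apply: vanish_iso; try exact: isomorphic_refl;
    [apply: isomorphic_sym|]; exact: unshift_sh.
by rewrite vanish_unshift IH opprB addrA addrAC.
Qed.

Lemma vanish_sh X Y m n : vanish (sh m X) (sh m Y) n <-> vanish X Y n.
Proof. by rewrite vanish_shl vanish_shr subrK. Qed.

Lemma vanish_retract_l X X' Y n : retract X X' -> vanish X' Y n -> vanish X Y n.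
Proof.
move=> [i [r ri]] h f.
by rewrite -[f]compm1 -ri compA (h (f \co r)) comp0m.
Qed.

Lemma vanish_retract_r X Y Y' n : retract Y Y' -> vanish X Y' n -> vanish X Y n.
Proof.
move=> hY h f; have [i [r ri]] : retract (sh n Y) (sh n Y').
  by case: n {h f} => n; elim: n => [|n IH] //=; try exact: fmap_retract.
by rewrite -[f]comp1m -ri -compA (h (i \co f)) compm0.
Qed.

Lemma vanish0r X Y n : is_zero_obj Y -> vanish X Y n.
Proof.
move=> zY f; apply: zero_obj_to.
by case: n {f} => n; elim: n => [|n IH] //=; try exact: fmap_zero_obj.
Qed.

(** Half-exactness of the functors Hom(-, V[n]) and Hom(W, -[n]) on
    triangles. *)
Lemma vanish_cone_l X Y Z (f : hom X Y) (g : hom Y Z) (h : hom Z (shift X))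
    V n :
  dist f g h -> vanish X V (n - 1) -> vanish Y V n -> vanish Z V n.
Proof.
move=> d vX vY k.
have [k' ->] : exists k', k = k' \co h.
  by apply: (dist_weak_cokernel (dist_rot d)); apply: vY.
have /(_ k') -> : vanish (shift X) (sh n V) 0; last exact: comp0m.
by rewrite -[0](addNr 1) vanish_shift vanish_shr addrC.
Qed.

Lemma vanish_cone_r X Y Z (f : hom X Y) (g : hom Y Z) (h : hom Z (shift X))
    W n :
  dist f g h -> vanish W X (n + 1) -> vanish W Y n -> vanish W Z n.
Proof.
move=> d vX vY; rewrite -[n]opprK -(sub0r (- n)) -vanish_shl => k.
have vX' : vanish (sh (- n) W) X 1 by rewrite vanish_shl opprK addrC.
have [k' ->] : exists k', k = g \co k'.
  by apply: (dist_weak_kernel (dist_rot d)); exact: vX'.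
have /(_ k') -> : vanish (sh (- n) W) Y 0; last exact: compm0.
by rewrite vanish_shl opprK add0r.
Qed.

End IntegerShift.

(** * The weight decomposition attached to a silting object *)

Section Decomposition.
Variables (T : triangulated_cat) (A : T).
Implicit Types X Y Z W V U : T.

(** The smallest class that contains the shifts of A and the zero objects, and
    is closed under isomorphisms and extensions. *)
Inductive filtered : T -> Prop :=
| filtered_zero Z : is_zero_obj Z -> filtered Z
| filtered_sh n Z : isomorphic (sh n A) Z -> filtered Z
| filtered_ext X Y Z (f : hom X Y) (g : hom Y Z) (h : hom Z (shift X)) :
    dist f g h -> filtered X -> filtered Z -> filtered Y.

Lemma filtered_shift X : filtered X -> filtered (shift X).
Proof.
elim=> [Z zZ|n Z e|U V W f g h d _ fU _ fW].
- by apply: filtered_zero; exact: fmap_zero_obj.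
- apply: (@filtered_sh (n + 1)).
  apply: isomorphic_trans (isomorphic_sym (shift_sh _ _)) _.
  exact: fmap_isomorphic.
- exact: filtered_ext (dist_shift d) fU fW.
Qed.

Lemma filtered_unshift X : filtered X -> filtered (unshift X).
Proof.
elim=> [Z zZ|n Z e|U V W f g h d _ fU _ fW].
- by apply: filtered_zero; exact: fmap_zero_obj.
- apply: (@filtered_sh (n - 1)).
  apply: isomorphic_trans (isomorphic_sym (unshift_sh _ _)) _.
  exact: fmap_isomorphic.
- have [a [_ [a' [da _ _ _]]]] := dist_unrotate d.
  have [b [_ [b' [db _ _ _]]]] := dist_unrotate da.
  have [c [_ [c' [dc _ _ _]]]] := dist_unrotate db.
  exact: filtered_ext dc fU fW.
Qed.

Lemma filtered_cone X Y Z (f : hom X Y) (g : hom Y Z) (h : hom Z (shift X)) :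
  dist f g h -> filtered X -> filtered Y -> filtered Z.
Proof. by move/dist_rot/filtered_ext => H /filtered_shift fX fY; exact: H. Qed.

(** The retracts of filtered objects form a thick subcategory: a map between
    retracts extends to a map between the filtered objects, and its cone is a
    retract of the cone of the extension. *)
Lemma thick_retracts_filtered :
  thick [set Z | exists X, retract Z X /\ filtered X].
Proof.
apply: thick_criterion => /=.
- move=> O zO; exists O; split; last exact: filtered_zero.
  exact: isomorphic_retract (isomorphic_refl O).
- move=> X Y [i [r ri]] [X' [[i' [r' ri']] fX']]; exists X'; split=> //.
  exists (i' \co i), (r \co r').
  by rewrite -compA (compA r') ri' comp1m.
- move=> X [X' [/(fmap_retract shift) e /filtered_shift h]].
  by exists (shift X').
- move=> X [X' [/(fmap_retract unshift) e /filtered_unshift h]].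
  by exists (unshift X').
- move=> X Y Z f g h d [X' [[i [r ri]] fX]] [Y' [[j [s sj]] fY]].
  have [Z' [g' [h' d']]] := dist_cone (j \co f \co r).
  exists Z'; split; last exact: filtered_cone d' fX fY.
  have [|c [cg hc]] := dist_morphism d d' (a := i) (b := j).
    by rewrite -!compA ri compm1.
  have [|e [eg he]] := dist_morphism d' d (a := r) (b := s).
    by rewrite !compA sj comp1m.
  (* the composite of the two maps between cones is invertible but need not be
     the identity *)
  have [|| k [kec _]] := @dist_endo_iso _ _ _ _ _ _ _ (e \co c) d.
  - by rewrite -compA cg compA eg -compA sj compm1.
  - by rewrite compA -he -compA -hc compA -fmap_comp ri fmap1 comp1m.
  by exists c, (k \co e); rewrite -compA.
Qed.

(** The objects W with no nonzero maps of positive degree from A; among silting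
    objects, those below A in the silting order. *)
Definition below : set T := [set W | forall i : int, (0 < i)%R -> vanish A W i].

(** The objects Z with no nonzero maps of positive degree to A. *)
Definition above : set T := [set Z | forall i : int, (0 < i)%R -> vanish Z A i].

(** The objects without nonzero maps to [below]. *)
Definition below_perp : set T :=
  [set U | forall W, below W -> forall f : hom U W, f = 0].

(** The objects without nonzero maps from [above]. *)
Definition above_perp : set T :=
  [set W | forall Z, above Z -> forall f : hom Z W, f = 0].

Lemma below_perp_ext : ext below_perp below_perp `<=` below_perp.
Proof.
move=> Y [X [Z [f [g [h [pX pZ d]]]]]] W bW k.
have [k' ->] := dist_weak_cokernel d (pX W bW (k \co f)).
by rewrite (pZ W bW k') comp0m.
Qed.

Lemma above_perp_ext : ext above_perp above_perp `<=` above_perp.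
Proof.
move=> Y [X [Z [f [g [h [pX pZ d]]]]]] W bW k.
have [k' ->] := dist_weak_kernel d (pZ W bW (g \co k)).
by rewrite (pX W bW k') compm0.
Qed.

Lemma below_ext : ext below below `<=` below.
Proof.
move=> Y [X [Z [f [g [h [pX pZ d]]]]]] i i0.
have [f' [_ [g' [d' _ _ _]]]] := dist_unrotate d.
apply: (vanish_cone_r d'); last exact: pX.
by apply: (vanish_shr A Z (-1) (i + 1)).2; rewrite addrK; exact: pZ.
Qed.

Lemma below_shift W : below W -> below (shift W).
Proof.
by move=> bW i i0; apply: (vanish_shr A W 1 i).2; apply: bW; lia.
Qed.

Lemma above_unshift Z : above Z -> above (unshift Z).
Proof.
by move=> aZ i i0; apply: (vanish_shl Z A (-1) i).2; apply: aZ; lia.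
Qed.

Lemma above_perp_shift W : above_perp W -> above_perp (shift W).
Proof.
move=> pW Z /above_unshift/pW v.
by apply: (vanish_unshift Z W 0).1.
Qed.

Hypothesis presilting : forall i : int, (0 < i)%R -> vanish A A i.

Lemma rsum_below : rsum A `<=` below.
Proof.
move=> W rW i i0; rewrite -[i]opprK -(sub0r (- i)) -vanish_shl.
apply: (@rsum_vanish_to _ A) rW.
by apply/(vanish_shl A A (- i) 0); rewrite opprK add0r; exact: presilting.
Qed.

Lemma rsum_above : rsum A `<=` above.
Proof. by move=> Z rZ i i0; apply: rsum_vanish_from rZ; exact: presilting. Qed.

Lemma above_perp_below : above_perp `<=` below.
Proof.
move=> W pW i i0; rewrite -[i]opprK -(sub0r (- i)) -vanish_shl.
apply: pW => j j0; apply/vanish_shl; rewrite opprK; apply: presilting; lia.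
Qed.

(** The objects with a three-step filtration by an object of [below_perp], a
    retract of a finite sum of copies of A, and an object of [above_perp]. *)
Definition decomposed : set T := ext below_perp (ext (rsum A) above_perp).

Lemma below_perp0 O : is_zero_obj O -> below_perp O.
Proof. by move=> zO W _ f; apply: zero_obj_from. Qed.

Lemma above_perp0 O : is_zero_obj O -> above_perp O.
Proof. by move=> zO W _ f; apply: zero_obj_to. Qed.

Lemma rsum_ext : ext (rsum A) (rsum A) `<=` rsum A.
Proof.
move=> Y [X [Z [f [g [h [rX rZ d]]]]]].
have h0 : h = 0.
  by apply: rsum_vanish_from rZ _; exact: (rsum_below rX (i := 1)).
rewrite h0 in d; have [s [r b]] := dist_split d.
exact: rsum_biproduct b rX rZ.
Qed.
Lemma middle0 O : is_zero_obj O -> ext (rsum A) above_perp O.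
Proof.
by move=> zO; apply: ext_left; [exact: above_perp0 | exact: rsum_zero].
Qed.

Lemma middle_below : ext (rsum A) above_perp `<=` below.
Proof.
move=> W /(ext_mono rsum_below above_perp_below); exact: below_ext.
Qed.

(** Writing M for [rsum A] and R for [above_perp], the class M * R * M * R lies
    in M * M * R * R, since R * M is contained in M * R. *)
Lemma middle_ext : ext (ext (rsum A) above_perp) (ext (rsum A) above_perp)
  `<=` ext (rsum A) above_perp.
Proof.
have swap : ext above_perp (rsum A) `<=` ext (rsum A) above_perp.
  apply: ext_swap => X Z /above_perp_shift pX /rsum_above; exact: pX.
move=> Y /ext_assoc_r.
move/(ext_mono (@subset_refl _ _) (@ext_assoc_l _ _ _ _)).
move/(ext_mono (@subset_refl _ _) (ext_mono swap (@subset_refl _ _))).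
move/(ext_mono (@subset_refl _ _) (@ext_assoc_r _ _ _ _)).
move/(ext_mono (@subset_refl _ _) (ext_mono (@subset_refl _ _) above_perp_ext)).
by move/ext_assoc_l; apply: ext_mono => //; exact: rsum_ext.
Qed.

(** The same regrouping as in [middle_ext], applied to [below_perp] and M *
    R. *)
Lemma decomposed_ext : ext decomposed decomposed `<=` decomposed.
Proof.
have swap : ext (ext (rsum A) above_perp) below_perp
    `<=` ext below_perp (ext (rsum A) above_perp).
  apply: ext_swap => X Z /middle_below/below_shift bX; exact.
move=> Y /ext_assoc_r.
move/(ext_mono (@subset_refl _ _) (@ext_assoc_l _ _ _ _)).
move/(ext_mono (@subset_refl _ _) (ext_mono swap (@subset_refl _ _))).
move/(ext_mono (@subset_refl _ _) (@ext_assoc_r _ _ _ _)).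
move/(ext_mono (@subset_refl _ _) (ext_mono (@subset_refl _ _) middle_ext)).
by move/ext_assoc_l; apply: ext_mono => //; exact: below_perp_ext.
Qed.

Lemma filtered_decomposed : filtered `<=` decomposed.
Proof.
move=> X; elim=> {X} [Z zZ|n Z e|U V W f g h d _ fU _ fW].
- by apply: ext_left; [exact: middle0 | exact: below_perp0].
- case: (ltgtP n 0) => n0.
  + apply: ext_left; first exact: middle0.
    move=> W bW; apply: hom_vanish_iso e (isomorphic_refl W) _.
    by apply/(vanish_shl A W n 0); apply: bW; lia.
  + apply: ext_right; first exact: below_perp0.
    apply: ext_right; first exact: rsum_zero.
    by move=> W aW; apply: hom_vanish_iso (isomorphic_refl W) e _; exact: aW.
  + apply: ext_right; first exact: below_perp0.
    apply: ext_left; first exact: above_perp0.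
    by rewrite n0 in e; exact: rsum_iso e (rsum_refl A).
- by apply: decomposed_ext; exists U, W, f, g, h.
Qed.

Hypothesis generates : smallest (@thick T) [set A] = setT.

(** Every object Z has a map x through which all maps from Z to objects of
    [below] factor, such that all composites of x with maps from objects of
    [above] factor through a fixed map a from an object of [rsum A]. *)
Lemma weak_decomposition Z : exists (X' W : T) (x : hom Z X') (a : hom W X'),
  [/\ rsum A W,
      forall Y (f : hom Z Y), below Y -> exists g, f = g \co x
    & forall V (f : hom V Z), above V -> exists g, x \co f = a \co g].
Proof.
have [X [[i [r ri]] /filtered_decomposed]] :
    exists X, retract Z X /\ filtered X.
  have : setT Z by []; rewrite -generates => h.
  apply: (h [set Z | exists X, retract Z X /\ filtered X]); split.
    exact: thick_retracts_filtered.
  move=> _ ->; exists A; split.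
    exact: isomorphic_retract (isomorphic_refl A).
  exact: (@filtered_sh 0) (isomorphic_refl A).
move=> [U [X' [u [x [k [pU [W [W' [a [b [k' [rW pW' d']]]]]] d]]]]]].
exists X', W, (x \co i), a; split=> //.
  move=> Y f bY.
  have [g eg] := dist_weak_cokernel d (pU Y bY (f \co r \co u)).
  by exists g; rewrite compA -eg -compA ri compm1.
move=> V f aV; apply: (dist_weak_kernel d'); exact: pW'.
Qed.

(** Maps from an object of [above] to objects of [below] factor through a fixed
    map to an object of [rsum A]; dually for maps from objects of [above] to an
    object of [below]. *)
Lemma above_approximation Z : above Z -> exists W (t : hom Z W),
  rsum A W /\ forall Y (f : hom Z Y), below Y -> exists g, f = g \co t.
Proof.
move=> aZ; have [X' [W [x [a [rW hb ha]]]]] := weak_decomposition Z.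
have [t et] := ha Z (idm Z) aZ; exists W, t; split=> // Y f bY.
have [g ->] := hb Y f bY.
by exists (g \co a); rewrite -compA -et compm1.
Qed.

Lemma below_approximation Y : below Y -> exists W (t : hom W Y),
  rsum A W /\ forall V (f : hom V Y), above V -> exists g, f = t \co g.
Proof.
move=> bY; have [X' [W [x [a [rW hb ha]]]]] := weak_decomposition Y.
have [p ep] := hb Y (idm Y) bY; exists W, (p \co a); split=> // V f aV.
have [g eg] := ha V f aV.
by exists g; rewrite -compA -eg compA -ep comp1m.
Qed.

(** For Z in [above] and Y in [below], Hom(Z, A) and Hom(A, Y) are finitely
    generated over End(A). *)
Lemma above_generators Z : above Z -> exists n (g : 'I_n -> hom Z A),
  forall f : hom Z A, exists c : 'I_n -> hom A A, f = \sum_i (c i \co g i).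
Proof.
move=> /above_approximation [W [t [[l e] ht]]].
exists (size l), (fun i => (tnth (in_tuple l) i).2 \co t) => f.
have [k ->] := ht A f (rsum_below (rsum_refl A)).
exists (fun i => k \co (tnth (in_tuple l) i).1).
rewrite -{1}[k]compm1 e big_tnth comp_sumr comp_suml.
by apply: eq_bigr => i _; rewrite !compA.
Qed.

Lemma below_generators Y : below Y -> exists n (g : 'I_n -> hom A Y),
  forall f : hom A Y, exists c : 'I_n -> hom A A, f = \sum_i (g i \co c i).
Proof.
move=> /below_approximation [W [t [[l e] ht]]].
exists (size l), (fun i => t \co (tnth (in_tuple l) i).1) => f.
have [k ->] := ht A f (rsum_above (rsum_refl A)).
exists (fun i => (tnth (in_tuple l) i).2 \co k).
rewrite -{1}[k]comp1m e big_tnth comp_suml comp_sumr.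
by apply: eq_bigr => i _; rewrite !compA.
Qed.

(** ** The nonvanishing lemma *)

(** The combinatorial core, by induction on the number of generators g of Hom(Y,
    A). The cone V of the map t from Y to a sum of copies of A given by g lies
    in [above], so maps from V to B factor through a map q to an object of [rsum
    A]. The composite of q with the map p from the copies of A to V kills t. If
    some entry in the first column of the matrix of this composite is
    invertible, the first generator is redundant. Otherwise every map from A to
    B is a combination of nonunits of End(A), and Nakayama's lemma applies. *)
Lemma nonvanishing_generators Y B n (g : 'I_n -> hom Y A) :
  local_ring (End A) -> above Y -> below B -> (forall f : hom Y B, f = 0) ->
  (forall f : hom Y A, exists c : 'I_n -> hom A A, f = \sum_i (c i \co g i)) ->
  (forall f : hom A B, f = 0) \/ (forall f : hom Y A, f = 0).
Proof.
move=> lA aY bB vYB; elim: n g => [|n IH] g gen.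
  by right=> f; have [c ->] := gen f; rewrite big_ord0.
have [S [inj u]] := has_coproducts (fun _ : 'I_n.+1 => A).
have [pr [pi pj e]] := coproduct_projections u.
pose t := \sum_i (inj i \co g i).
have prt i : pr i \co t = g i.
  rewrite /t comp_sumr (bigD1 i) //= compA pi comp1m big1 ?addr0 // => j ji.
  by rewrite compA pj ?comp0m // eq_sym.
have rS : rsum A S.
  by exists [seq (inj i, pr i) | i <- enum 'I_n.+1]; rewrite big_map big_enum.
have [V [p [h d]]] := dist_cone t.
(* in degree 1 this uses that g generates Hom(Y, A) *)
have aV : above V.
  move=> i i0; case: (eqVneq i 1) => [->|i1]; last first.
    by apply: (vanish_cone_l d); [apply: aY; lia | exact: (rsum_above rS)].
  move=> k.
  have kp : k \co p = 0 by apply: (rsum_above rS (i := 1)).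
  have [k' ->] := dist_weak_cokernel (dist_rot d) kp.
  have [k1 <-] := shift_full k'; have [c ->] := gen k1.
  have -> : \sum_i0 (c i0 \co g i0) = (\sum_j (c j \co pr j)) \co t.
    by rewrite comp_suml; apply: eq_bigr => j _; rewrite -compA prt.
  rewrite fmap_comp -compA.
  have := dist_comp0 (dist_rot (dist_rot d)).
  by rewrite compNm => /eqP; rewrite oppr_eq0 => /eqP ->; rewrite compm0.
have [W [q [[l eW] hq]]] := above_approximation aV.
(* the first column of the matrix of the composite of p and q *)
pose a j := (tnth (in_tuple l) j).2 \co q \co p \co inj ord0.
have at0 j : \sum_i ((tnth (in_tuple l) j).2 \co q \co p \co inj i \co g i) = 0.
  have pt := dist_comp0 d.
  rewrite -[RHS](compm0 _ ((tnth (in_tuple l) j).2 \co q)) -pt.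
  rewrite /t compA comp_sumr.
  by apply: eq_bigr => i _; rewrite !compA.
case: (pselect (exists j, is_iso (a j))) => [[j [b [ba ab]]]|na].
  (* the generator g_0 is redundant *)
  pose x i := (tnth (in_tuple l) j).2 \co q \co p \co inj i.
  have g0 : g ord0 = - (b \co \sum_i (x (lift ord0 i) \co g (lift ord0 i))).
    have := at0 j; rewrite big_ord_recl -/(a j) => /eqP.
    rewrite addr_eq0 => /eqP ea.
    by rewrite -[LHS]comp1m -ba -compA ea compmN.
  apply: (IH (fun i => g (lift ord0 i))) => f; have [c ->] := gen f.
  exists (fun i => c (lift ord0 i) - c ord0 \co b \co x (lift ord0 i)).
  rewrite big_ord_recl {1}g0 compmN addrC compA comp_sumr -sumrB.
  by apply: eq_bigr => i _; rewrite compBl !compA.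
left; have [m [hB genB]] := below_generators bB.
apply: (nakayama lA genB) => f.
have [k ek] : exists k, f \co pr ord0 = k \co p.
  by apply: (dist_weak_cokernel d); apply: vYB.
have [k' ek'] := hq B k bB.
exists (size l), (fun j => k' \co (tnth (in_tuple l) j).1), a; split.
  by move=> j aj; apply: na; exists j.
rewrite -[f]compm1 -(pi ord0) compA ek ek' -[k' in LHS]compm1 eW big_tnth.
rewrite comp_sumr !comp_suml; apply: eq_bigr => j _.
by rewrite /a !compA.
Qed.

(** If Y is in [above], B is in [below], and there are nonzero maps from Y to A
    and from A to B, then there is a nonzero map from Y to B. *)
Lemma nonvanishing Y B : local_ring (End A) -> above Y -> below B ->
  (forall f : hom Y B, f = 0) ->
  (forall f : hom A B, f = 0) \/ (forall f : hom Y A, f = 0).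
Proof.
move=> lA aY bB v; have [n [g gen]] := above_generators aY.
exact: nonvanishing_generators gen.
Qed.

End Decomposition.

(** * Indecomposable objects *)

Section Indecomposables.
Variable C : preadditive_cat.
Implicit Types X Y Z : C.

Lemma local_isomorphic X Y : isomorphic X Y -> local_ring (End X) ->
  local_ring (End Y).
Proof.
move=> [f [g [gf fg]]] [nz hD].
have hf : is_iso f by exists g.
have hg : is_iso g by exists f.
have tr (a : hom Y Y) : is_iso (g \co a \co f) <-> is_iso a.
  split=> h; last by do 2! apply: is_iso_comp => //.
  have -> : a = f \co (g \co a \co f) \co g.
    by rewrite !compA fg comp1m -compA fg compm1.
  by do 2! apply: is_iso_comp => //.
split.
  move=> e; apply: nz; have e' : idm Y = 0 by [].
  by rewrite -[1]gf -[f]comp1m e' comp0m compm0.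
move=> a b na nb; rewrite -[X in ~ X]/(is_iso (a + b)) -tr compDr compDl.
by apply: hD; [apply: contra_not na | apply: contra_not nb]; apply: (tr _).1.
Qed.
End Indecomposables.

Section TriangulatedIndecomposables.
Variable T : triangulated_cat.
Implicit Types X Y Z W V A B : T.
Implicit Types M N : set T.

Lemma indecomposable_retract X B : indecomposable X -> retract B X ->
  ~ is_zero_obj B -> isomorphic B X.
Proof.
move=> [_ hX] [i [r /retract_biproduct [Z [j [p [q b]]]]]] nB.
case: (hX _ _ _ _ (biproduct_coproduct b)) => // zZ.
case: b => pi _ _ _ e; exists i, p; split=> //.
by rewrite -e (zero_obj_from j zZ) comp0m addr0.
Qed.

Lemma indecomposable_isomorphic X Y : isomorphic X Y -> indecomposable X ->
  indecomposable Y.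
Proof.
move=> [f [g [gf fg]]] [nX hX]; split.
  by apply: contra_not nX; apply: zero_obj_retract; exists f, g.
move=> A B i j /coproduct_biproduct [p [q [pi qj pj qi e]]].
apply: (hX _ _ (g \co i) (g \co j)).
apply: (@biproduct_coproduct _ _ _ _ _ _ (p \co f) (q \co f)).
split; rewrite -?compA ?(compA f g) ?fg ?comp1m //.
by rewrite (compA i) (compA j) -compDr -compDl e comp1m gf.
Qed.

(** Indecomposability passes to shifts since a decomposition of a shift of X can
    be shifted back. *)
Lemma indecomposable_shift X : indecomposable X -> indecomposable (shift X).
Proof.
move=> iX; have [nX hX] := indecomposable_isomorphic
  (isomorphic_sym (unshift_shift_iso X)) iX.
split.
  by case: iX => nX' _; apply: contra_not nX'; exact: shift_zero_obj.
move=> A B i j /coproduct_biproduct [p [q b]].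
have := hX _ _ _ _ (biproduct_coproduct (fmap_biproduct unshift b)).
by case=> /unshift_zero_obj; [left|right].
Qed.

Lemma indecomposable_unshift X : indecomposable X -> indecomposable (unshift X).
Proof.
move=> iX; have [nX hX] := indecomposable_isomorphic
  (isomorphic_sym (shift_unshift_iso X)) iX.
split.
  by case: iX => nX' _; apply: contra_not nX'; exact: unshift_zero_obj.
move=> A B i j /coproduct_biproduct [p [q b]].
have := hX _ _ _ _ (biproduct_coproduct (fmap_biproduct shift b)).
by case=> /shift_zero_obj; [left|right].
Qed.

Lemma indecomposable_sh n X : indecomposable X -> indecomposable (sh n X).
Proof.
move=> iX; case: n => n; elim: n => [|n IH] //=.
- exact: indecomposable_shift.
- exact: indecomposable_unshift.
- exact: indecomposable_unshift.
Qed.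

Lemma local_summand X : krull_schmidt T -> ~ is_zero_obj X ->
  exists B, retract B X /\ local_ring (End B).
Proof.
move=> /(_ X) [[|n] [F [inj [u lF]]]] nX.
  case: nX; apply/zero_objP; have [k [_ uk]] := u X inj.
  by rewrite -(uk (idm X)) => [|[]//]; apply: uk => -[].
have [pr [pi _ _]] := coproduct_projections u.
by exists (F ord0); split=> //; exists (inj ord0), (pr ord0).
Qed.

Lemma indecomposable_local X : krull_schmidt T -> indecomposable X ->
  local_ring (End X).
Proof.
move=> ks iX; have [B [rB lB]] := local_summand ks iX.1.
apply: local_isomorphic (lB); apply: indecomposable_retract => //.
exact: local_not_zero.
Qed.

(** * Silting subcategories *)

Lemma rsum_subcategory A : subcategory (rsum A).
Proof.
split.
- move=> X Y; exact: rsum_iso.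
- move=> n F S inj /coproduct_projections [pr [_ _ e]] rF.
  rewrite /rsum /= -e; apply: factors_sum => i.
  by rewrite -[inj i]compm1; exact: factors_comp (rF i).
- move=> X Y S i j /coproduct_biproduct [p [q [pi _ _ _ _]]].
  by apply: rsum_retract; exists i, p.
Qed.

(** The additive closure of A consists of the retracts of finite sums of copies
    of A. *)
Lemma add_rsum A : add [set A] = rsum A.
Proof.
apply/seteqP; split=> [X|X [l e]].
  move/(_ (rsum A)); apply; split; first exact: rsum_subcategory.
  by move=> _ ->; exact: rsum_refl.
move=> M [sM /(_ A erefl) MA].
have [S [inj u]] := has_coproducts (fun _ : 'I_(size l) => A).
have [_ hM _] := sM; have MS := hM _ _ _ _ u (fun _ => MA).
have [r [hr _]] := u X (fun i => (tnth (in_tuple l) i).1).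
apply: subcategory_retract sM _ MS.
exists (\sum_i (inj i \co (tnth (in_tuple l) i).2)), r.
rewrite comp_sumr e [RHS]big_tnth; apply: eq_bigr => i _.
by rewrite compA hr.
Qed.

Lemma add_isomorphic A B : isomorphic A B -> add [set A] = add [set B].
Proof.
suff h X Y : isomorphic X Y -> add [set X] `<=` add [set Y].
  by move=> e; apply/seteqP; split; apply: h => //; exact: isomorphic_sym.
rewrite !add_rsum => e.
rewrite -add_rsum; apply: smallest_sub; first exact: rsum_subcategory.
by move=> _ ->; exact: rsum_iso (isomorphic_sym e) (rsum_refl Y).
Qed.

Lemma silting_objectP A : silting_object A <->
  (forall i : int, (0 < i)%R -> vanish A A i) /\
  smallest (@thick T) [set A] = setT.
Proof.
rewrite /silting_object; split=> [[_ h g]|[h g]].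
  split=> [[i|//] i0 f|].
    by apply: h => //; rewrite add_rsum; exact: rsum_refl.
  apply/seteqP; split=> // X _ P [tP AP].
  have : setT X by []; rewrite -g; apply; split=> //.
  by apply: smallest_sub AP; case: tP.
split.
- by rewrite add_rsum; exact: rsum_subcategory.
- rewrite add_rsum => X Y i rX rY i0.
  apply: rsum_vanish_from rX.
  exact: (rsum_below h rY (i := Posz i)).
- apply/seteqP; split=> // X _ P [tP AP].
  have : setT X by []; rewrite -g; apply; split=> // _ ->.
  by apply: AP; rewrite add_rsum; exact: rsum_refl.
Qed.

Lemma silting_object_sh n A : silting_object A -> silting_object (sh n A).
Proof.
move=> /silting_objectP [h g]; apply/silting_objectP; split.
  by move=> i i0; apply/vanish_sh; exact: h.
apply/seteqP; split=> // X _ P [tP AP].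
have : setT X by []; rewrite -g; apply; split=> // _ ->.
have [[Piso _ _] Ps Pu _] := tP.
have PA : P (sh n A) by exact: AP.
apply: (Piso (sh (- n) (sh n A))).
  by have := sh_add (- n) n A; rewrite addNr.
by case: (- n) => m; elim: m => [|m IH] //=; do ?[exact: Ps | exact: Pu].
Qed.

(** Degrees of nonzero maps between an object and a silting subcategory are
    bounded above. *)
Lemma silting_bound N Z : silting N -> exists K : nat, forall Y (i : int),
  N Y -> (K%:Z < i)%R -> vanish Z Y i /\ vanish Y Z i.
Proof.
move=> [_ hN gN]; have : setT Z by []; rewrite -gN => h.
apply: (h [set Z | exists K : nat, forall Y (i : int),
  N Y -> (K%:Z < i)%R -> vanish Z Y i /\ vanish Y Z i]); split; last first.
  move=> X NX; exists 0%N => Y [i|//] NY i0.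
  by split=> f; apply: hN f.
apply: thick_criterion => /=.
- move=> O zO; exists 0%N => Y i _ _; split; last exact: vanish0r.
  by move=> f; apply: zero_obj_from.
- move=> X Y rXY [K hK]; exists K => V i NV iK; have [h1 h2] := hK V i NV iK.
  by split; [exact: vanish_retract_l h1 | exact: vanish_retract_r h2].
- move=> X [K hK]; exists K.+1 => V i NV iK; split.
    by apply/(vanish_shl X V 1 i); apply: (hK _ _ NV _).1; lia.
  by apply/(vanish_shr V X 1 i); apply: (hK _ _ NV _).2; lia.
- move=> X [K hK]; exists K.+1 => V i NV iK; split.
    by apply/(vanish_shl X V (-1) i); apply: (hK _ _ NV _).1; lia.
  by apply/(vanish_shr V X (-1) i); apply: (hK _ _ NV _).2; lia.
- move=> X Y V f g k d [K hK] [L hL]; exists (K + L).+1 => W i NW iK; split.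
    apply: (vanish_cone_l d); first by apply: (hK _ _ NW _).1; lia.
    by apply: (hL _ _ NW _).1; lia.
  apply: (vanish_cone_r d); first by apply: (hK _ _ NW _).2; lia.
  by apply: (hL _ _ NW _).2; lia.
Qed.

(** There is a largest degree in which there are nonzero maps from X to N. *)
Lemma silting_top_degree N X : ~ is_zero_obj X -> silting N ->
  exists k : int, (exists Y, N Y /\ ~ vanish X Y k) /\
    forall Y (i : int), N Y -> (k < i)%R -> vanish X Y i.
Proof.
move=> nX sN.
have [i hi] : exists i, exists Y, N Y /\ ~ vanish X Y i.
  apply: contrapT => none.
  have [_ _ gN] := sN; have : setT X by []; rewrite -gN => h.
  apply: nX; apply/zero_objP.
  suff v : forall i, vanish X X i by exact: (v 0).
  apply: (h [set Z | forall i, vanish X Z i]); split; last first.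
    by move=> Y NY i; apply: contrapT => nv; apply: none; exists i, Y.
  apply: thick_criterion => /=.
  - by move=> O zO i; exact: vanish0r.
  - by move=> Y Z rYZ v i; exact: vanish_retract_r (v i).
  - by move=> Y v i; apply/(vanish_shr X Y 1 i).
  - by move=> Y v i; apply/(vanish_shr X Y (-1) i).
  - by move=> Y Z W f g k d v1 v2 i; exact: vanish_cone_r d _ _.
have [K hK] := silting_bound X sN.
have : exists d : nat, (K%:Z - i <= d%:Z)%R by exists (absz (K%:Z - i)); lia.
case=> d; elim: d => [|d IH] in i hi * => hd.
  by exists i; split=> // Y j NY ij; apply: (hK Y j NY _).1; lia.
case: (pselect (exists j : int, (i < j)%R /\ exists Y, N Y /\ ~ vanish X Y j)).
  by case=> j [ij hj]; apply: (IH j) => //; lia.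
move=> none; exists i; split=> // Y j NY ij; apply: contrapT => nv.
by apply: none; exists j; split=> //; exists Y.
Qed.

(** A silting subcategory N with no nonzero maps of positive degree from A, but
    with a nonzero map of degree 0 from A, is the additive closure of A. *)
Lemma silting_eq_add A N Y0 : krull_schmidt T -> indecomposable A ->
  silting_object A -> silting N ->
  (forall Y (i : int), N Y -> (0 < i)%R -> vanish A Y i) ->
  N Y0 -> ~ vanish A Y0 0 -> N = add [set A].
Proof.
move=> ks iA sA sN hAN NY0 nv.
have [subN hN _] := sN.
have below_N Y : N Y -> below A Y by move=> NY i; exact: hAN.
have [K hK] := silting_bound A sN.
have above_N Y : N Y -> above A Y.
  move=> NY i.
  (* downward induction on i, starting above the bound K *)
  have : exists d : nat, (K%:Z - i < d%:Z)%R.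
    by exists (absz (K%:Z - i)).+1; lia.
  case=> d; elim: d i => [|d IH] i hd i0; first by apply: (hK _ _ NY _).2; lia.
  have /silting_objectP [pA gA] := silting_object_sh i sA.
  (* Y, A[i] and Y0[i]: the maps from Y to Y0[i] vanish because N is silting *)
  case: (@nonvanishing _ (sh i A) pA gA Y (sh i Y0)).
  - exact: indecomposable_local (indecomposable_sh i iA).
  - by move=> j j0; apply/vanish_shr; apply: IH; lia.
  - by move=> j j0; apply/vanish_sh; exact: hAN.
  - case: i i0 {hd pA gA} => [i|//] i0; exact: hN.
  - by move=> v; case: nv; apply/(vanish_sh A Y0 i 0).
  - by [].
have /silting_objectP [pA gA] := sA.
(* the identity of Y factors through a sum of copies of A *)
have NA Y : N Y -> rsum A Y.
  move=> NY; have [W [t [rW ht]]] := above_approximation pA gA (above_N Y NY).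
  have [g eg] := ht Y (idm Y) (below_N Y NY).
  by apply: rsum_retract rW; exists t, g.
apply/seteqP; split=> [Y /NA|]; first by rewrite add_rsum.
apply: smallest_sub => // _ ->.
(* an indecomposable summand of Y0 is isomorphic to A *)
have [|B [rB lB]] := @local_summand Y0 ks.
  by move=> zY0; apply: nv; exact: vanish0r.
have NB : N B by exact: subcategory_retract rB NY0.
case: subN => Niso _ _; apply: Niso (NB).
apply: indecomposable_retract => //; last exact: local_not_zero.
by apply: rsum_local => //; exact: NA.
Qed.

(** If X is an indecomposable silting object, every silting subcategory is the
    additive closure of a shift of X. *)
Lemma silting_classification X N : krull_schmidt T -> indecomposable X ->
  silting_object X -> silting N -> exists n, N = add [set sh n X].
Proof.
move=> ks iX sX sN.
have [k [[Y0 [NY0 nv]] hk]] := silting_top_degree iX.1 sN.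
exists (- k); apply: (@silting_eq_add _ _ Y0) => //.
- exact: indecomposable_sh.
- exact: silting_object_sh.
- by move=> Y i NY i0; apply/vanish_shl; apply: hk => //; lia.
- by apply: contra_not nv => /vanish_shl; rewrite opprK add0r.
Qed.

(** * Mutation at the zero subcategory *)

Lemma zero_subcategory : subcategory [set O : T | is_zero_obj O].
Proof.
split=> /=.
- by move=> X Y /isomorphic_sym/isomorphic_retract; exact: zero_obj_retract.
- move=> n F S inj u zF; apply/zero_objP.
  have [k [_ uk]] := u S inj; rewrite -(uk (idm S)) => [|i]; last exact: comp1m.
  by apply: uk => i; rewrite comp0m; symmetry; apply: zero_obj_from.
- move=> X Y S i j /coproduct_biproduct [p [q [pi _ _ _ _]]].
  by apply: zero_obj_retract; exists i, p.
Qed.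

Lemma zero_removes_one B : krull_schmidt T -> indecomposable B ->
  removes_one_indecomposable (add [set B]) [set O | is_zero_obj O].
Proof.
move=> ks iB; split; first exact: zero_subcategory.
  by move=> O zO; rewrite add_rsum; exact: rsum_zero.
exists (iso_class B); rewrite add_rsum.
apply/seteqP; split=> [_ [[X [rX iX] <-] _]|_ ->] /=.
  have e : isomorphic X B.
    apply: indecomposable_retract => //; last exact: iX.1.
    exact: rsum_local (indecomposable_local ks iX) rX.
  apply/seteqP; split=> Y; apply: isomorphic_trans => //.
  exact: isomorphic_sym.
split; first by exists B => //; split=> //; exact: rsum_refl.
by case=> O [zO [nO _]].
Qed.

(** The triangle X -> 0 -> X[1]. *)
Lemma dist_zero X O : is_zero_obj O ->
  dist (0 : hom X O) (0 : hom O (shift X)) (- idm (shift X)).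
Proof. by move=> zO; rewrite -fmap1; apply: dist_rot; exact: dist_id. Qed.

(** The subcategory generated in a mutation of add B at the zero subcategory,
    where F is one of the two shift functors. *)
Lemma add_zero_image (F : additive_functor T T) B :
  add ([set O | is_zero_obj O] `|` F @` add [set B]) = add [set F B].
Proof.
apply/seteqP; split.
  apply: smallest_sub; first by rewrite add_rsum; exact: rsum_subcategory.
  rewrite !add_rsum => X [zX|[Y rY <-]]; first exact: rsum_zero.
  exact: fmap_rsum.
apply: smallest_sub.
  by split=> [X Y e h M [sM hM]|n G S inj u h M [sM hM]
      |X Y S i j b h M [sM hM]];
    have [h1 h2 h3] := sM; [apply: h1 e _ | apply: h2 u _ => i | apply: h3 b _];
    apply: h; split.
move=> _ -> M [sM hM]; apply: hM; right; exists B => //.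
by rewrite add_rsum; exact: rsum_refl.
Qed.

Lemma left_mutation_shift B : krull_schmidt T -> indecomposable B ->
  silting_object B -> irreducible_mutation (add [set B]) (add [set shift B]).
Proof.
move=> ks iB sB; split=> //; first exact: (silting_object_sh 1 sB).
have [O zO] := zero_obj_exists T.
have app X : left_approximation [set O | is_zero_obj O] (0 : hom X O).
  split=> // Y zY k; exists 0; rewrite compm0; symmetry; exact: zero_obj_to.
left; exists [set O | is_zero_obj O]; split.
- exact: zero_removes_one.
- by move=> X _; exists O, 0.
exists (@shift T); split; last by rewrite add_zero_image.
move=> X _; exists O, 0, 0, (- idm (shift X)); split=> //; exact: dist_zero.
Qed.

Lemma right_mutation_unshift B : krull_schmidt T -> indecomposable B ->
  silting_object B -> irreducible_mutation (add [set B]) (add [set unshift B]).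
Proof.
move=> ks iB sB; split=> //; first exact: (silting_object_sh (-1) sB).
have [O zO] := zero_obj_exists T.
have app X : right_approximation [set O | is_zero_obj O] (0 : hom O X).
  split=> // Y zY k; exists 0; rewrite comp0m; symmetry; exact: zero_obj_from.
right; exists [set O | is_zero_obj O]; split.
- exact: zero_removes_one.
- by move=> X _; exists O, 0.
exists (@unshift T); split; last by rewrite add_zero_image.
move=> X _; have [e ie] := isomorphic_sym (shift_unshift_iso X).
have [e' [e'e ee']] := ie.
exists O, 0, 0, (- e); split=> //.
apply: (dist_iso (is_iso_id _) (is_iso_id O) (_ : is_iso e') _ _ _
  (dist_zero (unshift X) zO)).
- by exists e.
- by rewrite !comp0m compm0.
- by rewrite compm0 comp0m.
- by rewrite fmap1 comp1m compNm ee'.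
Qed.

Lemma mutation_sh_path n X : krull_schmidt T -> indecomposable X ->
  silting_object X ->
  let path := clos_refl_trans (set T) (@irreducible_mutation T) in
  path (add [set X]) (add [set sh n X]) /\
  path (add [set sh n X]) (add [set X]).
Proof.
move=> ks iX sX path.
have up B : indecomposable B -> silting_object B ->
    path (add [set B]) (add [set shift B]) /\
    path (add [set shift B]) (add [set B]).
  move=> iB sB; split; apply: rt_step; first exact: left_mutation_shift.
  rewrite -(add_isomorphic (unshift_shift_iso B)).
  apply: right_mutation_unshift => //; first exact: indecomposable_shift.
  exact: (silting_object_sh 1 sB).
elim/int_step_ind: n => [|n [p1 p2]|n [p1 p2]].
- by split; apply: rt_refl.
- rewrite -(add_isomorphic (shift_sh n X)).
  have [q1 q2] := up _ (indecomposable_sh n iX) (silting_object_sh n sX).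
  by split; [apply: rt_trans p1 q1 | apply: rt_trans q2 p2].
- have [q1 q2] := up _ (indecomposable_sh (n - 1) iX)
    (silting_object_sh (n - 1) sX).
  have e := add_isomorphic (shift_sh (n - 1) X); rewrite subrK in e.
  rewrite e in q1 q2.
  by split; [apply: rt_trans p1 q2 | apply: rt_trans q1 p2].
Qed.

End TriangulatedIndecomposables.

Theorem corollary2p43 (T : triangulated_cat) :
  krull_schmidt T ->
  (exists X : T, indecomposable X /\ silting_object X) ->
  forall M N : set T, silt T M -> silt T N ->
    clos_refl_trans (set T) (@irreducible_mutation T) M N.
Proof.
move=> ks [X [iX sX]] M N sM sN.
have [m ->] := silting_classification ks iX sX sM.
have [n ->] := silting_classification ks iX sX sN.
apply: rt_trans (mutation_sh_path m ks iX sX).2 (mutation_sh_path n ks iX sX).1.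
Qed.
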